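(* Let $P=\{p<q\}$ and let $W=(X,X\to P)\in\mathrm{Sam}_P$ be a compact Lojasiewicz-Whitney stratified space (linearly rescaled so that it is cylindrically stratified), $\Phi$-stratified with respect to a continuous $\Phi:\mathrm{Sam}_\star\to[0,1]$. Then there exists $u_0\in(0,1)$ such that for all $u\in[u_0,1)$ and all sequences $\zeta_n\in(0,\infty)$, $\mathbb X_n\in\mathrm{Sam}$ with $\zeta_n\to\infty$ and $\zeta_n d_{\mathrm{Hd}}(\mathbb X_n,X)\to0$, $$\mathcal P\big(\mathcal S^u_{\zeta_n,\Phi}(\mathbb X_n)\big)\longrightarrow\mathcal P(W)\quad\text{in }\mathrm{Ho}(\mathrm{Diag}_P^{\Omega\times\mathbb R_+}).$$ Furthermore, for all $u\in[u_0,1)$, all $v\in\Omega$ and all such sequences, $$\mathcal P_v\big(\mathcal S^u_{\zeta_n,\Phi}(\mathbb X_n)\big)\longrightarrow\mathcal P_v(W)\quad\text{in }\mathrm{Ho}(\mathrm{Diag}_P^{\mathbb R_+}).$$ Here convergence is with respect to the interleaving distances.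
   Context: Fix $\mathbb R^N$ with Euclidean norm. ''Metric'' means symmetric Lawvere metric (value $\infty$ allowed, distinct points may have distance $0$). For $A\subset\mathbb R^N$, $\alpha\ge0$: $A_\alpha=\{y\mid \exists x\in A:\|x-y\|\le\alpha\}$. $\mathbb R_+=[0,\infty)$ as a poset. $B_r(x)$ is the closed ball. $\mathrm{Sam}$: all subsets of $\mathbb R^N$ with the Hausdorff distance $d_{\mathrm{Hd}}(\mathbb X,\mathbb X')=\inf\{\alpha>0\mid \mathbb X\subset\mathbb X'_\alpha,\ \mathbb X'\subset\mathbb X_\alpha\}$. $\mathrm{Sam}_P$: pairs $(\mathbb X,\mathbb X_p)$, $\mathbb X_p\subset\mathbb X\subset\mathbb R^N$. $\mathrm{Sam}_\star$: all subsets of $\mathbb R^N$ with metric $d_{\mathrm{Hd}}(\mathbb B\cap B_1(0),\mathbb B'\cap B_1(0))$. Whitney stratified over $P=\{p<q\}$: $W=(X,W_p)$ with $X\subset\mathbb R^N$ locally closed, $W_p$ closed in $X$, $W_q=X\setminus W_p$ dense in $X$, both strata smooth submanifolds of $\mathbb R^N$, and (condition (b)) for sequences $x_n\in W_q$, $y_n\in W_p$ both converging to some $y\in W_p$ such that the lines $l(x_n,y_n)=\mathrm{span}(x_n-y_n)$ converge to $l$ and $T_{x_n}W_q$ converge to $\tau$, one has $l\subset\tau$. The symbol $q$ also denotes $\dim W=\dim W_q$. For linear subspaces $\vec d(V,U)=\sup_{v\in V,\|v\|=1}\inf_{u\in U}\|v-u\|$; $\beta(x,y)=\vec d(l(x,y),T_xW_{s(x)})$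 for $x\neq y$ ($W_{s(x)}$ the stratum of $x$), $\beta(x,x)=0$. $W$ is Lojasiewicz-Whitney stratified if for every compact $K$ contained in a single stratum there are $\alpha>0,d_0>0$ with $\beta(x,y)\le\|y-x\|^\alpha$ for all $y\in K$, $x\in X\cap B_{d_0}(y)$. Magnification: $\mathcal M^\zeta_x(\mathbb X)=\zeta(\mathbb X-x)\cap B_1(0)$. Tangent cone: $T^{ex}_x(X)=\{v\mid\forall\varepsilon>0\ \exists y\in B_\varepsilon(x)\cap X: v\in(\mathbb R_{\ge0}(y-x))_\varepsilon\}$. $\Phi:\mathrm{Sam}_\star\to[0,1]$ is continuous with $\Phi(V)=1$ for every $q$-dimensional linear subspace $V$; $W$ ($q$-dimensional) is $\Phi$-stratified if $\Phi(T^{ex}_x(X))<1$ for all $x\in W_p$. $\mathcal S^u_{\zeta,\Phi}(\mathbb X)=(\mathbb X,\{x\in\mathbb X\mid \Phi(\mathcal M^\zeta_x(\mathbb X))\le u\})\in\mathrm{Sam}_P$. $\Omega=\{v=(v_l,v_u)\mid 0<v_l<v_u<1\}$ with order $v\le v'\iff v'_l\le v_l$ and $v_u\le v'_u$. For $S=(\mathbb X,\mathbb X_p)\in\mathrm{Sam}_P$ put $s(x)=\min\{d(x,\mathbb X_p),1\}$ ($d(x,\emptyset)=\infty$), $S_{\le a}=s^{-1}[0,a]$, $S^{a}=s^{-1}[a,1]$, $S^a_b=s^{-1}[a,b]$. $\mathrm{Diag}_P$: diagrams of ($\Delta$-generated) spaces $D_p\leftarrow D_{\{p<q\}}\to D_q$,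 weak equivalences being entrywise weak homotopy equivalences; $\mathrm{Ho}(\mathrm{Diag}_P^U)$ is the localization of the functor category at pointwise weak equivalences (the paper identifies it with $\mathrm{Ho}\,\mathrm{Top}_P^U$, the corresponding homotopy category of stratified spaces, via the homotopy link equivalence). $\mathcal P(S)$ is the functor $(v,\alpha)\mapsto\{(S_{\le v_u})_\alpha\hookleftarrow(S^{v_l}_{v_u})_\alpha\hookrightarrow(S^{v_l})_\alpha\}$ on $\Omega\times\mathbb R_+$ with inclusions as structure maps, and $\mathcal P_v(S)$ its restriction to $\{v\}\times\mathbb R_+$. Interleaving distances: on $\mathrm{Ho}(\mathrm{Diag}_P^{\mathbb R_+})$ use the shift $Y_\varepsilon(\alpha)=Y(\alpha+\varepsilon)$; on $\mathrm{Ho}(\mathrm{Diag}_P^{\Omega\times\mathbb R_+})$ use $Y_\varepsilon(v,\alpha)=Y((v_l-\varepsilon,v_u+\varepsilon),\alpha+\varepsilon)$ if $(v_l-\varepsilon,v_u+\varepsilon)\in\Omega$ and the terminal diagram otherwise. $Y,Z$ are $\varepsilon$-interleaved if there are morphisms $f:Y\to Z_\varepsilon$, $g:Z\to Y_\varepsilon$ in the homotopy category with $g_\varepsilon f$ and $f_\varepsilon g$ equal to the natural maps $Y\to Y_{2\varepsilon}$, $Z\to Z_{2\varepsilon}$; the distance is the infimum of such $\varepsilon$. Cylindrically stratified for $W=(X,W_p)$ with $s=\min\{d(-,W_p),1\}$: (i) there are a neighborhood $N$ of $W_p$ in $X$, a space $L$, a map $r:L\to W_p$ and a stratum preserving homeomorphism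 $N\cong M_r$, where $M_r=L\times(0,1]\sqcup W_p$ (with $p$-stratum $W_p$) has the teardrop topology, generated by the open subsets of $L\times(0,1]$ and preimages of open sets under $M_r\to W_p\times[0,1]$, $(l,t)\mapsto(r(l),t)$, $y\mapsto(y,0)$; (ii) there is a homeomorphism $s^{-1}(0,1)\cong s^{-1}(\tfrac12)\times(0,1)$ over $(0,1)$. *)

(* Defs.v *)
From HB Require Import structures.
From mathcomp Require Import all_boot all_order all_algebra.
From mathcomp Require Import all_classical all_reals all_analysis.

Set Implicit Arguments.
Unset Strict Implicit.
Unset Printing Implicit Defensive.
Import Order.TTheory GRing.Theory Num.Theory.
Import numFieldNormedType.Exports.

Local Open Scope classical_set_scope.
Local Open Scope ring_scope.

Record category := Category {
  ob :> Type;
  hom : ob -> ob -> Type;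
  idm : forall x, hom x x;
  comp : forall x y z, hom y z -> hom x y -> hom x z;
  compm1 : forall x y (f : hom x y), comp f (idm x) = f;
  comp1m : forall x y (f : hom x y), comp (idm y) f = f;
  compA : forall x y z w (h : hom z w) (g : hom y z) (f : hom x y),
    comp h (comp g f) = comp (comp h g) f
}.
Arguments hom {c} x y.
Arguments idm {c} x.
Arguments comp {c x y z} g f.

Record functor (C D : category) := Functor {
  fob :> C -> D;
  fmap : forall x y : C, hom x y -> hom (fob x) (fob y);
  fmap1 : forall x : C, fmap (idm x) = idm (fob x);
  fmapM : forall (x y z : C) (g : hom y z) (f : hom x y),
    fmap (comp g f) = comp (fmap g) (fmap f)
}.
Arguments fmap {C D} F {x y} f : rename.

Record nat_trans (C D : category) (F G : functor C D) := NatTrans {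
  nt_app :> forall x : C, hom (F x) (G x);
  nt_nat : forall (x y : C) (f : hom x y),
    comp (nt_app y) (fmap F f) = comp (fmap G f) (nt_app x)
}.

Lemma nat_trans_ext (C D : category) (F G : functor C D)
  (a b : nat_trans F G) : (forall x, a x = b x) -> a = b.
Proof.
case: a b => [a na] [b nb] /= ab.
have {}ab : a = b by apply: functional_extensionality_dep.
by subst b; congr NatTrans; exact: Prop_irrelevance.
Qed.

Section functor_category.
Variables C D : category.

Lemma nt_id_nat (F : functor C D) (x y : C) (f : hom x y) :
  comp (idm (F y)) (fmap F f) = comp (fmap F f) (idm (F x)).
Proof. by rewrite comp1m compm1. Qed.

Definition nt_id (F : functor C D) : nat_trans F F :=
  NatTrans (nt_id_nat F).

Lemma nt_comp_nat (F G H : functor C D) (b : nat_trans G H)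
    (a : nat_trans F G) (x y : C) (f : hom x y) :
  comp (comp (b y) (a y)) (fmap F f) = comp (fmap H f) (comp (b x) (a x)).
Proof. by rewrite -compA nt_nat compA nt_nat compA. Qed.

Definition nt_comp (F G H : functor C D) (b : nat_trans G H)
  (a : nat_trans F G) : nat_trans F H := NatTrans (nt_comp_nat b a).

Definition functor_cat : category.
Proof.
refine (@Category (functor C D) (@nat_trans C D) nt_id nt_comp _ _ _).
- by move=> F G a; apply: nat_trans_ext => x; exact: compm1.
- by move=> F G a; apply: nat_trans_ext => x; exact: comp1m.
- by move=> F G H K c b a; apply: nat_trans_ext => x; exact: compA.
Defined.

End functor_category.

Record preorder := Preorder {
  pcarrier :> Type;
  ple : pcarrier -> pcarrier -> Prop;
  ple_refl : forall x, ple x x;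
  ple_trans : forall x y z, ple y z -> ple x y -> ple x z
}.
Arguments ple {p} x y.

Definition preorder_cat (U : preorder) : category.
Proof.
refine (@Category U (fun x y => ple x y) (@ple_refl U) (@ple_trans U) _ _ _).
- by move=> x y f; exact: (@Prop_irrelevance (ple x y)).
- by move=> x y f; exact: (@Prop_irrelevance (ple x y)).
- by move=> x y z w h g f; exact: (@Prop_irrelevance (ple x w)).
Defined.

Lemma preorder_hom_irr (U : preorder) (x y : preorder_cat U) (f g : hom x y) :
  f = g.
Proof. exact: (@Prop_irrelevance (@ple U x y)). Qed.

Definition precomp (U V : preorder) (D : category) (t : U -> V)
    (tP : forall x y, ple x y -> ple (t x) (t y))
    (F : functor (preorder_cat V) D) : functor (preorder_cat U) D.
Proof.
refine (@Functor (preorder_cat U) D (fun x => F (t x))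
  (fun x y xy => fmap F (tP x y xy)) _ _).
- by move=> x; rewrite -[RHS]fmap1; congr (fmap F _); exact: preorder_hom_irr.
- by move=> x y z g f; rewrite -fmapM; congr (fmap F _);
    exact: preorder_hom_irr.
Defined.

(* A category with a class of morphisms to be inverted. *)
Record relcat := Relcat {
  rcat :> category;
  weq : forall x y : rcat, hom x y -> Prop;
  weq_id : forall x, weq (idm x)
}.
Arguments weq {r x y} f.

(* The functor category D^U, with pointwise weak equivalences. *)
Definition pointwise (U : preorder) (D : relcat) : relcat.
Proof.
refine (@Relcat (functor_cat (preorder_cat U) D)
  (fun F G a => forall x : U, weq (nt_app a x)) _).
by move=> F x; exact: weq_id.
Defined.

(* The localization of C at its weak equivalences, by generators and
   relations: the morphisms of Ho C are the elements of [ho_hom] up to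
   [ho_eq]. *)
Section localization.
Variable C : relcat.

Inductive ho_hom : C -> C -> Type :=
| ho_of x y : hom x y -> ho_hom x y
| ho_inv x y (w : hom x y) : weq w -> ho_hom y x
| ho_comp x y z : ho_hom y z -> ho_hom x y -> ho_hom x z.

Inductive ho_eq : forall x y : C, ho_hom x y -> ho_hom x y -> Prop :=
| ho_eq_refl x y (f : ho_hom x y) : ho_eq f f
| ho_eq_sym x y (f g : ho_hom x y) : ho_eq f g -> ho_eq g f
| ho_eq_trans x y (f g h : ho_hom x y) :
    ho_eq f g -> ho_eq g h -> ho_eq f h
| ho_eq_comp x y z (g g' : ho_hom y z) (f f' : ho_hom x y) :
    ho_eq g g' -> ho_eq f f' -> ho_eq (ho_comp g f) (ho_comp g' f')
| ho_eq_compA x y z t (h : ho_hom z t) (g : ho_hom y z) (f : ho_hom x y) :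
    ho_eq (ho_comp h (ho_comp g f)) (ho_comp (ho_comp h g) f)
| ho_eq_1m x y (f : ho_hom x y) : ho_eq (ho_comp (ho_of (idm y)) f) f
| ho_eq_m1 x y (f : ho_hom x y) : ho_eq (ho_comp f (ho_of (idm x))) f
| ho_eq_of x y z (g : hom y z) (f : hom x y) :
    ho_eq (ho_of (comp g f)) (ho_comp (ho_of g) (ho_of f))
| ho_eq_Vw x y (w : hom x y) (ww : weq w) :
    ho_eq (ho_comp (ho_inv ww) (ho_of w)) (ho_of (idm x))
| ho_eq_wV x y (w : hom x y) (ww : weq w) :
    ho_eq (ho_comp (ho_of w) (ho_inv ww)) (ho_of (idm y)).

End localization.
Arguments ho_of {C x y} _.

Definition preserves_weq (C D : relcat) (F : functor C D) :=
  forall (x y : C) (w : hom x y), weq w -> weq (fmap F w).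

Fixpoint ho_map (C D : relcat) (F : functor C D) (FW : preserves_weq F)
    (x y : C) (f : ho_hom x y) : ho_hom (F x) (F y) :=
  match f in ho_hom x y return ho_hom (F x) (F y) with
  | ho_of _ _ f => ho_of (fmap F f)
  | ho_inv _ _ _ ww => ho_inv (FW _ _ _ ww)
  | ho_comp _ _ _ g f => ho_comp (ho_map FW g) (ho_map FW f)
  end.

(* [sh] is the shift functor Y |-> Y_e and [sh_unit] the natural map
   Y -> Y_e. *)
Record shift (C : relcat) := Shift {
  sh : functor C C;
  sh_weq : preserves_weq sh;
  sh_unit : forall Y, hom Y (sh Y);
  sh_nat : forall (Y Z : C) (f : hom Y Z),
    comp (sh_unit Z) f = comp (fmap sh f) (sh_unit Y)
}.

(* Y_(2e) is written (Y_e)_e, its natural map being Y -> Y_e -> (Y_e)_e. *)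
Definition interleaved (C : relcat) (S : shift C) (Y Z : C) :=
  exists (f : ho_hom Y (sh S Z)) (g : ho_hom Z (sh S Y)),
    ho_eq (ho_comp (ho_map (@sh_weq _ S) g) f)
          (ho_of (comp (sh_unit S (sh S Y)) (sh_unit S Y))) /\
    ho_eq (ho_comp (ho_map (@sh_weq _ S) f) g)
          (ho_of (comp (sh_unit S (sh S Z)) (sh_unit S Z))).

Definition interleaving_dist (R : realType) (C : relcat)
    (S : {nonneg R} -> shift C) (Y Z : C) : \bar R :=
  ereal_inf [set (e%:num)%:E | e in [set e | interleaved (S e) Y Z]].

(* Shifting diagrams along a partially defined monotone map t : U -> U with
   x <= t x, with the terminal object wherever t is not defined. *)
Record terminal (C : category) := Terminal {
  t_ob : C;
  t_bang : forall x, hom x t_ob;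
  t_uniq : forall x (f g : hom x t_ob), f = g
}.

Definition ole (U : preorder) (a b : option U) : Prop :=
  match b, a with
  | None, _ => True
  | Some y, Some x => ple x y
  | Some _, None => False
  end.

Lemma ole_refl (U : preorder) (a : option U) : ole a a.
Proof. by case: a => //= x; exact: ple_refl. Qed.

Lemma ole_trans (U : preorder) (a b c : option U) : ole b c -> ole a b -> ole a c.
Proof. by case: a b c => [x|] [y|] [z|] //=; exact: ple_trans. Qed.

Definition add_top (U : preorder) := Preorder (@ole_refl U) (@ole_trans U).

Section extend_by_terminal.
Variables (U : preorder) (D : relcat) (T : terminal D).
Implicit Types F G : functor (preorder_cat U) D.

Definition ext_ob F (a : option U) : D :=
  if a is Some x then F x else t_ob T.

Definition ext_map F (a b : option U) : ole a b -> hom (ext_ob F a) (ext_ob F b) :=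
  match b, a return ole a b -> hom (ext_ob F a) (ext_ob F b) with
  | None, a => fun _ => t_bang T (ext_ob F a)
  | Some y, Some x => fun xy => @fmap (preorder_cat U) D F x y xy
  | Some y, None => fun absurd => False_rect _ absurd
  end.

Definition ext F : functor (preorder_cat (add_top U)) D.
Proof.
refine (@Functor (preorder_cat (add_top U)) D (ext_ob F) (ext_map F) _ _).
- case=> [x|]; last exact: t_uniq.
  by rewrite -[RHS]fmap1; congr (fmap F _); exact: preorder_hom_irr.
- move=> [x|] [y|] [z|] // g f; try exact: t_uniq.
  by rewrite /= -fmapM; congr (fmap F _); exact: preorder_hom_irr.
Defined.

Definition ext_nt_app F G (n : nat_trans F G) (a : option U) :
    hom (ext_ob F a) (ext_ob G a) :=
  match a with Some x => n x | None => idm (t_ob T) end.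

Lemma ext_nt_nat F G (n : nat_trans F G) (a b : option U) (ab : ole a b) :
  comp (ext_nt_app n b) (ext_map F ab) = comp (ext_map G ab) (ext_nt_app n a).
Proof.
by move: a b ab => [x|] [y|] //= ab; [exact: nt_nat | exact: t_uniq..].
Qed.

Variable t : U -> option U.
Hypothesis tP : forall x y, ple x y -> ole (t x) (t y).
Hypothesis t_ge : forall x, ole (Some x) (t x).

Definition shift_ob F : functor (preorder_cat U) D :=
  @precomp U (add_top U) D t tP (ext F).

Definition shift_map F G (n : nat_trans F G) :
    nat_trans (shift_ob F) (shift_ob G) :=
  @NatTrans _ _ (shift_ob F) (shift_ob G) (fun x => ext_nt_app n (t x))
    (fun x y xy => ext_nt_nat n (tP xy)).

Definition shift_functor : functor (pointwise U D) (pointwise U D).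
Proof.
refine (@Functor (pointwise U D) (pointwise U D) shift_ob shift_map _ _).
- by move=> F; apply: nat_trans_ext => x /=; case: (t x).
- move=> F G H b a; apply: nat_trans_ext => x /=.
  by case: (t x) => //=; exact: t_uniq.
Defined.

Lemma shift_weq : preserves_weq shift_functor.
Proof. by move=> F G w ww x /=; case: (t x) => //=; exact: weq_id. Qed.

Definition shift_unit F : nat_trans F (shift_ob F).
Proof.
refine (@NatTrans _ _ F (shift_ob F)
  (fun x => @fmap _ _ (ext F) (Some x) (t x) (t_ge x)) _).
move=> x y xy.
rewrite -[LHS](@fmapM _ _ (ext F) (Some x) (Some y) (t y) (t_ge y) xy).
rewrite -[RHS](@fmapM _ _ (ext F) (Some x) (t x) (t y) (tP xy) (t_ge x)).
exact: (f_equal (@fmap _ _ (ext F) (Some x) (t y)) (preorder_hom_irr _ _)).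
Defined.

Definition partial_shift : shift (pointwise U D).
Proof.
refine (@Shift (pointwise U D) shift_functor shift_weq shift_unit _).
by move=> F G n; apply: nat_trans_ext => x /=; exact: esym (ext_nt_nat n (t_ge x)).
Defined.

End extend_by_terminal.

(* The same set with the final topology with respect to all continuous maps
   from simplices. *)
Definition deltaification (R : realType) (T : topologicalType) : Type := T.

Section spaces.
Variable R : realType.

Definition simplex n : set 'rV[R]_n.+1 :=
  [set x | (forall i, 0 <= x 0 i) /\ \sum_i x 0 i = 1].

Arguments simplex n : clear implicits.

Definition delta_open (T : topologicalType) (A : set T) :=
  forall n (s : simplex n -> T), continuous s -> open (s @^-1` A).

Definition delta_generated (T : topologicalType) :=
  forall A : set T, delta_open A -> open A.

Section deltaification.
Variable T : topologicalType.

HB.instance Definition _ := Choice.copy (deltaification R T) T.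

Lemma delta_openT : delta_open [set: T].
Proof. by move=> n s _; rewrite preimage_setT; exact: openT. Qed.

Lemma delta_openI : setI_closed (@delta_open T).
Proof. by move=> A B oA oB n s cs; exact: openI (oA n s cs) (oB n s cs). Qed.

Lemma delta_open_bigU (I : Type) (f : I -> set T) :
  (forall i, delta_open (f i)) -> delta_open (\bigcup_i f i).
Proof.
by move=> of_ n s cs; rewrite preimage_bigcup; apply: bigcup_open => i _;
  exact: of_.
Qed.

HB.instance Definition _ := @isOpenTopological.Build (deltaification R T)
  (@delta_open T) delta_openT delta_openI delta_open_bigU.

End deltaification.

Lemma deltaification_gen (T : topologicalType) :
  delta_generated (deltaification R T).
Proof.
move=> A oA; suff : @delta_open T A by [].
move=> n s cs; apply: oA; apply/continuousP => B oB; exact: oB.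
Qed.

Lemma deltaification_continuous (S T : topologicalType) (f : S -> T) :
  continuous f -> continuous (f : deltaification R S -> deltaification R T).
Proof.
move=> cf; apply/continuousP => A oA; suff : @delta_open S (f @^-1` A) by [].
move=> n s cs.
by apply: (oA n (f \o s)) => x; apply: continuous_comp; [exact: cs|exact: cf].
Qed.

Record dspace := DSpace {
  dcarrier :> topologicalType;
  dgen : delta_generated dcarrier
}.

Record dmap (X Y : dspace) := DMap {
  dfun :> X -> Y;
  dcts : continuous dfun
}.

Arguments dcts {X Y} d x : rename.

Lemma dmap_ext (X Y : dspace) (f g : dmap X Y) : f =1 g -> f = g.
Proof.
case: f g => [f cf] [g cg] /= /funext fg; subst g.
by congr DMap; exact: Prop_irrelevance.
Qed.

Lemma id_cts (T : topologicalType) : continuous (@id T).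
Proof. by move=> x; exact: cvg_id. Qed.

Definition dmap_id (X : dspace) : dmap X X := DMap (@id_cts X).

Lemma dmap_comp_cts (X Y Z : dspace) (g : dmap Y Z) (f : dmap X Y) :
  continuous (g \o f).
Proof. by move=> x; exact: (continuous_comp (dcts f x) (dcts g (f x))). Qed.

Definition dmap_comp (X Y Z : dspace) (g : dmap Y Z) (f : dmap X Y) :
  dmap X Z := DMap (@dmap_comp_cts X Y Z g f).

Definition dtop_cat : category.
Proof.
by refine (@Category dspace dmap dmap_id dmap_comp _ _ _) => *;
  exact: dmap_ext.
Defined.

Definition joined (T : topologicalType) (x y : T) :=
  exists p : `[0, 1 : R]%classic -> T, continuous p /\
    forall s, (set_val s = 0 -> p s = x) /\ (set_val s = 1 -> p s = y).

Definition cube n : set 'rV[R]_n := [set t | forall i, 0 <= t 0 i <= 1].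

Arguments cube n : clear implicits.

Definition cube_boundary n : set (cube n) :=
  [set t : cube n | exists i, let x : 'rV[R]_n := set_val t in
     x 0 i = 0 \/ x 0 i = 1].

(* Representatives of the elements of pi_n (T, x). *)
Definition sphere_map n (T : topologicalType) (x : T) (a : cube n -> T) :=
  continuous a /\ forall t, cube_boundary t -> a t = x.

Definition sphere_homotopic n (T : topologicalType) (x : T)
    (a b : cube n -> T) :=
  exists H : (cube n * `[0, 1 : R]%classic)%type -> T, continuous H /\
    forall t s, [/\ set_val s = 0 -> H (t, s) = a t,
                    set_val s = 1 -> H (t, s) = b t &
                    cube_boundary t -> H (t, s) = x].

(* Bijectivity on pi_0 and on pi_n (X, x) -> pi_n (Y, f x), n >= 1. *)
Definition weak_homotopy_equivalence (X Y : topologicalType) (f : X -> Y) :=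
  [/\ continuous f,
   forall x x', joined (f x) (f x') -> joined x x',
   forall y, exists x, joined (f x) y &
   forall n (x : X), (0 < n)%N ->
     (forall a a' : cube n -> X, sphere_map x a -> sphere_map x a' ->
        sphere_homotopic (f x) (f \o a) (f \o a') ->
        sphere_homotopic x a a') /\
     (forall b : cube n -> Y, sphere_map (f x) b ->
        exists2 a, sphere_map x a & sphere_homotopic (f x) (f \o a) b)].

Lemma weak_homotopy_equivalence_id (X : topologicalType) :
  weak_homotopy_equivalence (@id X).
Proof.
split=> [|x x' //|y|n x n0].
- exact: id_cts.
- by exists y, (fun=> y); split=> [|s //]; exact: cst_continuous.
- split=> [a a' _ _ //|b bP]; exists b => //.
  exists (b \o fst); split=> [p|t s].
    by apply: continuous_comp; [exact: cvg_fst|exact: bP.1].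
  by split=> //= bt; exact: bP.2.
Qed.

Definition dtop : relcat :=
  @Relcat dtop_cat (fun X Y f => weak_homotopy_equivalence f)
    (fun X => @weak_homotopy_equivalence_id X).

(* The flags of P; [Fpq] is {p < q}, so that functors on [flag] are diagrams
   D_p <- D_{p<q} -> D_q. *)
Variant flag_t := Fp | Fpq | Fq.

Definition flag_le (i j : flag_t) : Prop :=
  match i, j with
  | Fpq, _ | Fp, Fp | Fq, Fq => True
  | _, _ => False
  end.

Lemma flag_le_refl i : flag_le i i.
Proof. by case: i. Qed.

Lemma flag_le_trans i j k : flag_le j k -> flag_le i j -> flag_le i k.
Proof. by case: i j k => [] [] []. Qed.

Definition flag := Preorder flag_le_refl flag_le_trans.

Definition DiagP : relcat := pointwise flag dtop.

Lemma dpoint_gen : delta_generated (deltaification R (discrete_topology unit)).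
Proof. exact: deltaification_gen. Qed.

Definition dpoint : dspace := DSpace dpoint_gen.

Definition dpoint_terminal : terminal dtop.
Proof.
refine (@Terminal dtop dpoint
  (fun X => DMap (fun x => @cst_continuous X dpoint tt x)) _).
by move=> X f g; apply: dmap_ext => x; case: (f x) (g x) => [] [].
Defined.

Definition DiagP_terminal : terminal DiagP.
Proof.
pose c : functor (preorder_cat flag) dtop :=
  @Functor (preorder_cat flag) dtop (fun=> dpoint) (fun _ _ _ => idm _)
    (fun=> erefl) (fun x y z g f => esym (comp1m (idm (dpoint : dtop)))).
refine (@Terminal DiagP c
  (fun F => @NatTrans _ _ F c (fun i => t_bang dpoint_terminal (F i)) _) _).
- by move=> i j ij; exact: (t_uniq (t := dpoint_terminal)).
- by move=> F a b; apply: nat_trans_ext => i;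
    exact: (t_uniq (t := dpoint_terminal)).
Defined.

(* Subsets of R^N, ordered by inclusion, as Delta-generated spaces. *)
Section subsets.
Variable N : nat.
Let E := 'rV[R]_N.

Definition subspace_dtop (A : set E) : dspace :=
  DSpace (@deltaification_gen A).

Definition incl (A B : set E) (AB : A `<=` B) (x : A) : B :=
  SigSub (mem_set (AB _ (set_mem (valP x)))).

Lemma incl_continuous (A B : set E) (AB : A `<=` B) : continuous (incl AB).
Proof.
apply/continuousP => _ [W oW <-].
by exists W.
Qed.

Definition incl_dmap (A B : set E) (AB : A `<=` B) :
    @hom dtop (subspace_dtop A) (subspace_dtop B) :=
  @DMap (subspace_dtop A) (subspace_dtop B) (incl AB)
    (deltaification_continuous (@incl_continuous _ _ AB)).

Section subset_diagram.
Variables (U : preorder) (A : U -> flag -> set E).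
Hypothesis Ai : forall u i j, ple i j -> A u i `<=` A u j.
Hypothesis Au : forall i u v, ple u v -> A u i `<=` A v i.

Definition subset_diagram_at (u : U) : functor (preorder_cat flag) dtop.
Proof.
refine (@Functor (preorder_cat flag) dtop
  (fun i => subspace_dtop (A u i)) (fun i j ij => incl_dmap (Ai ij)) _ _).
- by move=> i; apply: dmap_ext => x; exact: val_inj.
- by move=> i j k g f; apply: dmap_ext => x; exact: val_inj.
Defined.

Lemma subset_diagram_nat (u v : U) (uv : ple u v) (i j : preorder_cat flag)
    (ij : hom i j) :
  comp (incl_dmap (@Au j u v uv)) (fmap (subset_diagram_at u) ij) =
  comp (fmap (subset_diagram_at v) ij) (incl_dmap (@Au i u v uv)).
Proof. by apply: dmap_ext => x; exact: val_inj. Qed.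

Definition subset_diagram : pointwise U DiagP.
Proof.
refine (@Functor (preorder_cat U) DiagP subset_diagram_at
  (fun u v uv => @NatTrans _ _ (subset_diagram_at u) (subset_diagram_at v)
     (fun i => incl_dmap (Au uv)) (subset_diagram_nat uv)) _ _).
- by move=> u; apply: nat_trans_ext => i; apply: dmap_ext => x; exact: val_inj.
- by move=> u v w g f; apply: nat_trans_ext => i; apply: dmap_ext => x;
    exact: val_inj.
Defined.

End subset_diagram.

End subsets.

Lemma nonneg_le_trans (x y z : {nonneg R}) : y <= z -> x <= y -> x <= z.
Proof. by move=> yz xy; exact: le_trans xy yz. Qed.

Definition Rplus : preorder :=
  @Preorder {nonneg R} (fun x y => x <= y) (fun x => lexx x) nonneg_le_trans.

(* Pairs (v_l, v_u). *)
Definition Omega := {v : R * R | [&& 0 < v.1, v.1 < v.2 & v.2 < 1]}.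

Definition Omega_le (v w : Omega) : Prop :=
  ((val w).1 <= (val v).1) /\ ((val v).2 <= (val w).2).

Lemma OmegaR_refl (a : Omega * {nonneg R}) :
  Omega_le a.1 a.1 /\ a.2 <= a.2.
Proof. by split=> //; split. Qed.

Lemma OmegaR_trans (a b c : Omega * {nonneg R}) :
  Omega_le b.1 c.1 /\ b.2 <= c.2 -> Omega_le a.1 b.1 /\ a.2 <= b.2 ->
  Omega_le a.1 c.1 /\ a.2 <= c.2.
Proof.
move=> [[bc1 bc2] bc] [[ab1 ab2] ab].
by split; [split; [exact: le_trans ab1|exact: le_trans bc2]|exact: le_trans bc].
Qed.

Definition OmegaR : preorder := Preorder OmegaR_refl OmegaR_trans.

(* Total, so that the terminal object does not occur in [Rplus_shift]. *)
Definition Rplus_add (e : {nonneg R}) (a : Rplus) : option Rplus :=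
  Some ((a%:num + e%:num)%:nng : Rplus).

Lemma Rplus_addP e (x y : Rplus) : ple x y -> ole (Rplus_add e x) (Rplus_add e y).
Proof. by move=> xy; rewrite /= -num_le /= lerD2r num_le. Qed.

Lemma Rplus_add_ge e (x : Rplus) : ole (Some x) (Rplus_add e x).
Proof. by rewrite /= -num_le /= lerDl. Qed.

Definition Rplus_shift (e : {nonneg R}) : shift (pointwise Rplus DiagP) :=
  @partial_shift Rplus DiagP DiagP_terminal (Rplus_add e) (@Rplus_addP e) (@Rplus_add_ge e).

Definition Omega_add (e : {nonneg R}) (v : Omega) : option Omega :=
  insub ((val v).1 - e%:num, (val v).2 + e%:num).

Definition OmegaR_add (e : {nonneg R}) (a : OmegaR) : option OmegaR :=
  omap (fun v => (v, (a.2%:num + e%:num)%:nng) : OmegaR) (Omega_add e a.1).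

Lemma OmegaR_addP e (x y : OmegaR) :
  ple x y -> ole (OmegaR_add e x) (OmegaR_add e y).
Proof.
case: x y => [v a] [w b] [[/= wv1 vw2] ab].
rewrite /OmegaR_add /Omega_add /=.
case: (insubP _ ((val w).1 - e%:num, (val w).2 + e%:num)) => //= w' w'O w'E.
have h1 : (val w).1 - e%:num <= (val v).1 - e%:num by rewrite lerD2r.
have h2 : (val v).2 + e%:num <= (val w).2 + e%:num by rewrite lerD2r.
case: insubP => [v' _ v'E|] /=.
  split; last by rewrite -num_le /= lerD2r num_le.
  by split; rewrite /= [sval w']w'E [sval v']v'E.
case/and3P: w'O => /= w1 _ w3; rewrite (lt_le_trans w1 h1) (le_lt_trans h2 w3).
have /and3P[_ v12 _] := valP v.
rewrite andbT /=.
by rewrite (le_lt_trans _ (lt_le_trans v12 _)) // ?lerDl ?gerBl.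
Qed.

Lemma OmegaR_add_ge e (x : OmegaR) : ole (Some x) (OmegaR_add e x).
Proof.
rewrite /OmegaR_add /Omega_add; case: insubP => //= v' _ v'E.
split; last by rewrite -num_le /= lerDl.
by split; rewrite /= [sval v']v'E /= ?gerBl ?lerDl.
Qed.

Definition OmegaR_shift (e : {nonneg R}) : shift (pointwise OmegaR DiagP) :=
  @partial_shift OmegaR DiagP DiagP_terminal (OmegaR_add e) (@OmegaR_addP e) (@OmegaR_add_ge e).

Section samples.
Variable N : nat.
Let E := 'rV[R]_N.

(* The norm of the library on 'rV[R]_N is the sup norm. *)
Definition enorm (x : E) : R := Num.sqrt (\sum_i x 0 i ^+ 2).

Definition eball (x : E) (r : R) : set E := [set y | enorm (y - x) <= r].

Definition thicken (A : set E) (a : R) : set E :=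
  [set y | exists2 x, A x & enorm (x - y) <= a].

Definition dHd (A B : set E) : \bar R :=
  ereal_inf [set a%:E | a in
    [set a : R | [/\ 0 < a, A `<=` thicken B a & B `<=` thicken A a]]].

Definition dstar (A B : set E) : \bar R :=
  dHd (A `&` eball 0 1) (B `&` eball 0 1).

Record samP := SamP {
  amb : set E;
  sing : set E;
  sing_sub : sing `<=` amb
}.

Definition reg (S : samP) : set E := amb S `\` sing S.

(* d(x, set0) = +oo is truncated to 1. *)
Definition strat_dist (S : samP) (x : E) : R :=
  fine (Order.min (ereal_inf [set (enorm (x - y))%:E | y in sing S]) 1%E).

Definition sub_le (S : samP) (a : R) : set E :=
  [set x | amb S x /\ strat_dist S x <= a].
Definition sub_ge (S : samP) (a : R) : set E :=
  [set x | amb S x /\ a <= strat_dist S x].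
Definition sub_bt (S : samP) (a b : R) : set E :=
  [set x | amb S x /\ a <= strat_dist S x <= b].

Definition persistent_set (S : samP) (u : OmegaR) (i : flag) : set E :=
  let vl := (val u.1).1 in let vu := (val u.1).2 in
  match i with
  | Fp => thicken (sub_le S vu) u.2%:num
  | Fpq => thicken (sub_bt S vl vu) u.2%:num
  | Fq => thicken (sub_ge S vl) u.2%:num
  end.

Lemma thickenS (A B : set E) a b :
  A `<=` B -> a <= b -> thicken A a `<=` thicken B b.
Proof.
by move=> AB ab y [x Ax xy]; exists x; [exact: AB|exact: le_trans ab].
Qed.

Lemma persistent_set_flag S u (i j : flag) :
  ple i j -> persistent_set S u i `<=` persistent_set S u j.
Proof.
by case: i j => [] [] //= _; apply: thickenS => // x [Xx /andP[? ?]]; split.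
Qed.

Lemma persistent_set_mono S i (u v : OmegaR) :
  ple u v -> persistent_set S u i `<=` persistent_set S v i.
Proof.
case: u v => [u a] [v b] [[/= l1 l2] ab].
have {}ab : a%:num <= b%:num by rewrite num_le.
case: i => /=; apply: thickenS => // x [Xx xP]; split=> //.
- exact: le_trans l2.
- by case/andP: xP => x1 x2; rewrite (le_trans l1) // (le_trans x2).
- exact: le_trans xP.
Qed.

Definition persistent (S : samP) : pointwise OmegaR DiagP :=
  @subset_diagram N OmegaR (persistent_set S) (@persistent_set_flag S)
    (@persistent_set_mono S).

Lemma at_v_mono (v : Omega) (a b : Rplus) :
  ple a b -> ple ((v, a) : OmegaR) ((v, b) : OmegaR).
Proof. by move=> ab; split=> //; split. Qed.

Definition persistent_at (v : Omega) (S : samP) : pointwise Rplus DiagP :=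
  @precomp Rplus OmegaR DiagP (fun a => (v, a)) (@at_v_mono v) (persistent S).

Definition magnification (z : R) (x : E) (A : set E) : set E :=
  [set z *: (y - x) | y in A] `&` eball 0 1.

Definition ex_tangent_cone (A : set E) (x : E) : set E :=
  [set v | forall e, 0 < e -> exists2 y, (eball x e `&` A) y &
     thicken [set c *: (y - x) | c in [set c | 0 <= c]] e v].

Definition sam_star_continuous (Phi : set E -> R) :=
  forall A e, 0 < e -> exists2 d, 0 < d &
    forall B, (dstar A B < d%:E)%E -> `|Phi A - Phi B| < e.

Lemma stratify_sub (Phi : set E -> R) (z u : R) (A : set E) :
  [set x | A x /\ Phi (magnification z x A) <= u] `<=` A.
Proof. by move=> x []. Qed.

Definition stratify (Phi : set E -> R) (z u : R) (A : set E) : samP :=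
  SamP (@stratify_sub Phi z u A).

(* C^k on the open set U: all iterated directional derivatives up to order k
   exist and are continuous on U. *)
Fixpoint Ck (V W : normedModType R) (k : nat) (U : set V) (f : V -> W) :=
  match k with
  | 0 => forall x, U x -> {for x, continuous f}
  | k.+1 => forall v, (forall x, U x -> derivable f x v) /\ Ck k U ('D_v f)
  end.

Definition smooth (V W : normedModType R) (U : set V) (f : V -> W) :=
  forall k, Ck k U f.

(* Near x, M is carried onto an open subset of R^d x 0 by a diffeomorphism
   between open subsets of R^N. *)
Definition flat_near (d : nat) (M : set E) (x : E) :=
  (d <= N)%N /\
  exists (U V : set E) (f g : E -> E),
    [/\ open U, U x, open V & [/\ smooth U f, smooth V g,
     (forall y, U y -> V (f y) /\ g (f y) = y),
     (forall z, V z -> U (g z) /\ f (g z) = z) &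
     (forall y, U y ->
        (M y <-> forall i : 'I_N, (d <= i)%N -> f y 0 i = 0))]].

Definition submanifold_of_dim (d : nat) (M : set E) :=
  forall x, M x -> flat_near d M x.

(* Components may have different dimensions. *)
Definition submanifold (M : set E) :=
  forall x, M x -> exists d, flat_near d M x.

(* Velocities at x of smooth curves in M. *)
Definition tangent_space (M : set E) (x : E) : set E :=
  [set v | exists (c : R^o -> E) (e : R),
     [/\ 0 < e, smooth (`]- e, e[%classic : set R^o) c,
         (forall t, - e < t < e -> M (c t)), c 0 = x &
         'D_(1 : R^o) c 0 = v]].

Definition line (x y : E) : set E := [set` <[x - y]>%VS].

(* [sup set0 = 0], so vec_d {0} U = 0. *)
Definition vec_d (V U : set E) : R :=
  sup [set inf [set enorm (v - u) | u in U] |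
        v in V `&` [set v | enorm v = 1]].

(* Convergence in the Grassmannian. *)
Definition subspace_cvg (V : nat -> set E) (L : {vspace E}) :=
  (fun n => vec_d (V n) [set` L]) @ \oo --> 0 /\
  (fun n => vec_d [set` L] (V n)) @ \oo --> 0.

Definition whitney_b (q : nat) (W : samP) :=
  forall (x_ y_ : nat -> E) (y : E) (l t : {vspace E}),
    (forall n, reg W (x_ n)) -> (forall n, sing W (y_ n)) -> sing W y ->
    x_ @ \oo --> y -> y_ @ \oo --> y ->
    \dim l = 1%N -> \dim t = q ->
    subspace_cvg (fun n => line (x_ n) (y_ n)) l ->
    subspace_cvg (fun n => tangent_space (reg W) (x_ n)) t ->
    (l <= t)%VS.

Record whitney_stratified (q : nat) (W : samP) : Prop := {
  ws_locally_closed : exists O C, [/\ open O, closed C & amb W = O `&` C];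
  ws_sing_closed : exists2 C, closed C & sing W = amb W `&` C;
  ws_reg_dense : amb W `<=` closure (reg W);
  ws_sing_smooth : submanifold (sing W);
  ws_reg_smooth : submanifold_of_dim q (reg W);
  ws_b : whitney_b q W
}.

Definition stratum_of (W : samP) (x : E) : set E :=
  if x \in sing W then sing W else reg W.

Definition whitney_beta (W : samP) (x y : E) : R :=
  if x == y then 0 else vec_d (line x y) (tangent_space (stratum_of W x) x).

Definition lojasiewicz_whitney (q : nat) (W : samP) :=
  whitney_stratified q W /\
  forall K : set E, compact K -> (K `<=` sing W \/ K `<=` reg W) ->
    exists (a d0 : R), [/\ 0 < a, 0 < d0 &
      forall y x, K y -> (amb W `&` eball y d0) x ->
        whitney_beta W x y <= enorm (y - x) `^ a].

Definition homeomorphism (S T : topologicalType) (h : S -> T) :=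
  continuous h /\
  exists g : T -> S, [/\ continuous g, cancel h g & cancel g h].

End samples.

End spaces.

Definition teardrop (R : realType) (L B : topologicalType) (r : L -> B) : Type :=
  (L * `]0, 1 : R]%classic + B)%type.

Section teardrop.
Variables (R : realType) (L B : topologicalType) (r : L -> B).
Local Notation M := (teardrop R r).

HB.instance Definition _ :=
  Choice.copy M (L * `]0, 1 : R]%classic + B)%type.

(* The map to B x [0,1]; taking B x R as codomain does not change the family
   of preimages of open sets. *)
Definition teardrop_proj (m : M) : B * R :=
  match m with
  | inl (l, t) => (r l, set_val t)
  | inr y => (y, 0)
  end.

Definition teardrop_subbase : set (set M) :=
  [set (inl @` O : set M) | O in
     [set O : set (L * `]0, 1 : R]%classic)%type | open O]] `|`
  [set teardrop_proj @^-1` O | O in [set O : set (B * R)%type | open O]].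

HB.instance Definition _ :=
  @isSubBaseTopological.Build M (set M : pointedType) teardrop_subbase id.

End teardrop.

Definition cylindrically_stratified (R : realType) (N : nat)
    (W : samP R N) : Prop :=
  (exists (O A : set 'rV[R]_N) (L : topologicalType) (r : L -> sing W)
      (h : A -> teardrop R r),
    [/\ open O, sing W `<=` O `&` amb W, O `&` amb W `<=` A, A `<=` amb W &
     [/\ continuous r, homeomorphism h &
      forall x, sing W (set_val x) <-> exists y, h x = inr y]]) /\
  (exists h : [set x | amb W x /\ 0 < strat_dist W x < 1] ->
      ([set x | amb W x /\ strat_dist W x = 2^-1] * `]0, 1 : R[%classic)%type,
    homeomorphism h /\ forall x, set_val (h x).2 = strat_dist W (set_val x)).

(* Main.v *)
Require Import Defs.
From mathcomp Require Import all_boot all_order all_algebra.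
From mathcomp Require Import all_classical all_reals all_analysis.
From mathcomp Require Import ring lra.

Set Implicit Arguments.
Unset Strict Implicit.
Unset Printing Implicit Defensive.
Import Order.TTheory GRing.Theory Num.Theory.
Import numFieldNormedType.Exports.
Local Open Scope classical_set_scope.
Local Open Scope ring_scope.

(** The sample enters through two estimates. At a point of the singular stratum
    a large magnification of a fine sample looks like the extrinsic tangent
    cone, on which [Phi] is less than [1]; at a regular point it looks like a
    linear subspace of dimension [q], on which [Phi] equals [1]. Both hold
    locally uniformly in the base point, so by compactness the threshold test
    [Phi <= u] returns, for [u] close enough to [1] and in the limit, exactly the
    points near the singular stratum: the pair [stratify Phi zeta u S] is
    Hausdorff close to [W] ([stratify_close]).

    Uniformity at regular points is strict differentiability of a chart and of
    its inverse ([regular_conic_along]). At singular points it comes from the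
    Lojasiewicz condition. At distance [s] from a singular point [y], the radial
    direction lies within [s `^ p] of the tangent space of the stratum, so a
    curve in the space that heads radially for [y] turns at rate at most
    [s `^ p / s] per unit length. This rate is integrable at [0]: directions
    converge, at a speed that does not depend on [y]. The argument is made
    discrete in [transport], an extremal choice of a point of the space whose
    direction has drifted by at most a multiple of the variation of [s `^ p].
    Hence the space is conical about each singular point uniformly in the point
    ([radially_conic]), which identifies the limit of the magnifications with
    the tangent cone, even for base points that move along the stratum
    ([ex_tangent_cone_conic_along]).

    Once the pairs are Hausdorff close, all interleavings are inclusions of
    subsets ([subset_diagram_interleaved]). With both parameters shifted this is
    immediate, since the distance to the singular stratum changes by at most
    twice the Hausdorff distance ([persistent_close]). When [v] is fixed, the
    sets [level W l u i] must themselves depend continuously on [l] and [u]. That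
    is where the cylinder is used: a point strictly between the strata has
    points of every nearby level close to it ([cylindrical_levels]), and
    compactness turns this into Hausdorff continuity of the levels
    ([level_shrink], [level_grow], [persistent_at_close]). *)

(** * The Euclidean norm and the topology of row vectors *)

Section euclidean_norm.
Variables (R : realType) (N : nat).
Implicit Types (x y z : 'rV[R]_N) (a : R).

Lemma enorm_sqr x : enorm x ^+ 2 = \sum_i x 0 i ^+ 2.
Proof. by rewrite sqr_sqrtr// sumr_ge0// => i _; rewrite sqr_ge0. Qed.

Lemma enorm_ge0 x : 0 <= enorm x.
Proof. exact: sqrtr_ge0. Qed.
Hint Resolve enorm_ge0 : core.

Lemma enormZ a x : enorm (a *: x) = `|a| * enorm x.
Proof.
rewrite /enorm -sqrtr_sqr -sqrtrM ?sqr_ge0//; congr Num.sqrt.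
by rewrite mulr_sumr; apply: eq_bigr => i _; rewrite mxE exprMn.
Qed.

Lemma enorm0 : enorm (0 : 'rV[R]_N) = 0.
Proof. by rewrite -(scale0r 0) enormZ normr0 mul0r. Qed.

Lemma enormN x : enorm (- x) = enorm x.
Proof. by rewrite -scaleN1r enormZ normrN1 mul1r. Qed.

Lemma enormB x y : enorm (x - y) = enorm (y - x).
Proof. by rewrite -enormN opprB. Qed.

Lemma cauchy_schwarz x y :
  \sum_i x 0 i * y 0 i <= enorm x * enorm y.
Proof.
set d := (X in X <= _).
(* The quadratic form [s, t |-> |s x - t y|^2] is nonnegative. *)
have H s t : 0 <= s ^+ 2 * enorm x ^+ 2 - 2 * s * t * d + t ^+ 2 * enorm y ^+ 2.
  rewrite !enorm_sqr.
  suff -> : s ^+ 2 * (\sum_i x 0 i ^+ 2) - 2 * s * t * d +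
      t ^+ 2 * (\sum_i y 0 i ^+ 2) = \sum_i (s * x 0 i - t * y 0 i) ^+ 2.
    by rewrite sumr_ge0// => i _; rewrite sqr_ge0.
  rewrite !mulr_sumr -sumrB -big_split/=; apply: eq_bigr => i _; ring.
have [x0|x0] := eqVneq (enorm x) 0; last first.
  have xp : 0 < enorm x by rewrite lt_neqAle eq_sym x0 enorm_ge0.
  have [y0|y0] := eqVneq (enorm y) 0.
    have := H (d / enorm x ^+ 2) 1.
    have -> : (d / enorm x ^+ 2) ^+ 2 * enorm x ^+ 2 - 2 * (d / enorm x ^+ 2) * 1 * d +
      1 ^+ 2 * enorm y ^+ 2 = - (d / enorm x) ^+ 2 + enorm y ^+ 2 by field.
    rewrite y0 expr0n addr0 oppr_ge0 => h.
    have /eqP : (d / enorm x) ^+ 2 = 0 by apply/eqP; rewrite eq_le h sqr_ge0.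
    by rewrite sqrf_eq0 mulf_eq0 invr_eq0 (negPf x0) orbF mulr0 => /eqP ->.
  have yp : 0 < enorm y by rewrite lt_neqAle eq_sym y0 enorm_ge0.
  have := H (enorm y) (enorm x).
  have -> : enorm y ^+ 2 * enorm x ^+ 2 - 2 * enorm y * enorm x * d +
     enorm x ^+ 2 * enorm y ^+ 2 =
     2 * (enorm x * enorm y) * (enorm x * enorm y - d) by ring.
  by rewrite pmulr_rge0 ?subr_ge0// mulr_gt0// mulr_gt0.
have : \sum_i x 0 i ^+ 2 == 0 by rewrite -enorm_sqr x0 expr0n.
rewrite psumr_eq0 => [/allP h|i _]; last exact: sqr_ge0.
rewrite x0 mul0r /d big1// => i _.
have := h i (mem_index_enum i); rewrite /= sqrf_eq0 => /eqP ->; exact: mul0r.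
Qed.

Lemma enormD x y : enorm (x + y) <= enorm x + enorm y.
Proof.
rewrite -(@ler_pXn2r _ 2)// ?nnegrE ?addr_ge0//.
rewrite sqrrD !enorm_sqr.
have -> : \sum_i (x + y) 0 i ^+ 2 = \sum_i x 0 i ^+ 2 +
    (\sum_i x 0 i * y 0 i) *+ 2 + \sum_i y 0 i ^+ 2.
  rewrite -sumrMnl -!big_split/=; apply: eq_bigr => i _.
  by rewrite mxE sqrrD.
by rewrite lerD2r lerD2l lerMn2r/= cauchy_schwarz.
Qed.

Lemma enorm_tri y x z : enorm (x - z) <= enorm (x - y) + enorm (y - z).
Proof. by rewrite -[x - z](subrKA y); exact: enormD. Qed.

Lemma enorm_dist x y : `|enorm x - enorm y| <= enorm (x - y).
Proof.
rewrite ler_norml; apply/andP; split.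
  by have := enormD (y - x) x; rewrite subrK enormB; lra.
by have := enormD (x - y) y; rewrite subrK; lra.
Qed.

Lemma enorm_eq0 x : (enorm x == 0) = (x == 0).
Proof.
apply/eqP/eqP => [x0|->]; last exact: enorm0.
have : \sum_i x 0 i ^+ 2 == 0 by rewrite -enorm_sqr x0 expr0n.
rewrite psumr_eq0 => [/allP h|i _]; last exact: sqr_ge0.
apply/rowP => i; rewrite mxE.
by have := h i (mem_index_enum i); rewrite /= sqrf_eq0 => /eqP.
Qed.

Lemma enorm_gt0 x : (0 < enorm x) = (x != 0).
Proof. by rewrite lt_neqAle eq_sym enorm_eq0 enorm_ge0 andbT. Qed.

(** The topology of row vectors is that of the sup norm [`|x|]; this bound and
    [enorm_le_norm] let topological statements pass to the Euclidean norm. *)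
Lemma norm_le_enorm x : `|x| <= enorm x.
Proof.
rewrite [leLHS]/Num.Def.normr/= mx_normrE; apply: bigmax_le => // -[i j] _ /=.
rewrite -(@ler_pXn2r _ 2)// ?nnegrE// real_normK ?num_real// enorm_sqr.
by rewrite (bigD1 j)//= (ord1 i) lerDl sumr_ge0// => k _; rewrite sqr_ge0.
Qed.

Lemma coord_le_norm x i : `|x 0 i| <= `|x|.
Proof.
rewrite [leRHS]/Num.Def.normr/= mx_normrE.
exact: (le_bigmax _ (fun ij : 'I_1 * 'I_N => `|x ij.1 ij.2|) (0, i)).
Qed.

(** The constant [N.+1] replaces the optimal [sqrt N] so that it can be divided by
    also when [N = 0]. *)
Lemma enorm_le_norm x : enorm x <= N.+1%:R * `|x|.
Proof.
rewrite -(@ler_pXn2r _ 2)// ?nnegrE ?mulr_ge0// enorm_sqr exprMn.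
apply: (@le_trans _ _ (\sum_(i < N) `|x| ^+ 2)).
  apply: ler_sum => i _.
  by rewrite -(@real_normK _ (x 0 i)) ?num_real// lerXn2r ?nnegrE// coord_le_norm.
rewrite sumr_const card_ord -[leLHS]mulr_natl ler_wpM2r ?sqr_ge0// -natrX ler_nat.
by rewrite (leq_trans (leqnSn N))// leq_pmulr.
Qed.

Lemma near_enorm x e : 0 < e -> \forall y \near x, enorm (y - x) < e.
Proof.
move=> e0; have e1 : 0 < e / N.+1%:R by rewrite divr_gt0.
near=> y.
rewrite (le_lt_trans (enorm_le_norm _))// mulrC -ltr_pdivlMr//.
Unshelve. all: by end_near. Qed.

Lemma enorm_nbhs x (A : set 'rV[R]_N) :
  nbhs x A -> exists2 e, 0 < e & forall y, enorm (y - x) < e -> A y.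
Proof.
move=> /nbhs_ballP[e /= e0 eA]; exists e => // y yx; apply: eA.
rewrite -ball_normE/=; apply: le_lt_trans yx.
by rewrite -normrN opprB norm_le_enorm.
Qed.

Lemma enorm_continuous : continuous (@enorm R N).
Proof.
move=> x; apply/(@cvgrPdist_lt _ _ _ (nbhs x)) => e e0.
apply: filterS (near_enorm x e0) => y yx.
by apply: le_lt_trans (enorm_dist _ _) _; rewrite enormB.
Qed.

(** The form in which compactness enters every uniform estimate below. *)
Lemma compact_common_scale (K : set 'rV[R]_N) (Q : R -> 'rV[R]_N -> Prop) :
  compact K ->
  (forall r r' x, 0 < r' -> r' <= r -> Q r x -> Q r' x) ->
  (forall x, K x -> exists2 r, 0 < r &
     forall y, K y -> enorm (y - x) < r -> Q r y) ->
  exists2 r, 0 < r & forall x, K x -> Q r x.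
Proof.
move=> /compact_near_coveringP cK Qmono Qloc.
have [|e /= e0 eP] := cK R (0^'+) (fun r y => K y -> Q r y) _.
  move=> x /Qloc[r r0 rQ]; near=> y s => /= Ky.
  apply: (Qmono r); [by near: s; exact: nbhs_right_gt| |].
    by near: s; exact: nbhs_right_le.
  by apply: rQ => //; near: y; exact: near_enorm.
exists (e / 2); first by rewrite divr_gt0.
move=> x Kx; apply: eP => //=; last by rewrite divr_gt0.
rewrite /ball_/= sub0r normrN gtr0_norm ?divr_gt0//; lra.
Unshelve. all: by end_near. Qed.

End euclidean_norm.
#[export] Hint Extern 0 (is_true (0 <= enorm _)) => solve [apply: enorm_ge0] : core.

(** * Interleavings by inclusions *)

Section interleaving_by_inclusions.
Variables (R : realType) (N : nat) (U : preorder).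

(** [A] includes into the shift of [B] by the partial map [t]; where [t] is
    undefined the shifted diagram is terminal and there is no condition. *)
Definition sub_shift (t : U -> option U) (A B : U -> flag -> set 'rV[R]_N) :=
  forall u u' i, t u = Some u' -> A u i `<=` B u' i.

Section maps.
Variables (t : U -> option U).
Hypothesis tP : forall x y, ple x y -> ole (t x) (t y).
Hypothesis t_ge : forall x, ole (Some x) (t x).
Local Notation Sh := (@partial_shift U (DiagP R) (DiagP_terminal R) t tP t_ge).

Section one_map.
Variables A B : U -> flag -> set 'rV[R]_N.
Hypothesis Ai : forall u i j, ple i j -> A u i `<=` A u j.
Hypothesis Au : forall i u v, ple u v -> A u i `<=` A v i.
Hypothesis Bi : forall u i j, ple i j -> B u i `<=` B u j.
Hypothesis Bu : forall i u v, ple u v -> B u i `<=` B v i.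
Hypothesis AB : sub_shift t A B.
Let F := subset_diagram Ai Au.
Let G := subset_diagram Bi Bu.

Lemma incl_shift_flag_nat u u' (AB' : forall i, A u i `<=` B u' i)
    (i j : preorder_cat flag) (ij : Defs.hom i j) :
  Defs.comp (incl_dmap (AB' j)) (Defs.fmap (subset_diagram_at Ai u) ij) =
  Defs.comp (Defs.fmap (subset_diagram_at Bi u') ij) (incl_dmap (AB' i)).
Proof. by apply: dmap_ext => x; exact: val_inj. Qed.

(** The component at [u] of the inclusion, with [o] in place of [t u]: only for a
    variable [o] can the dependent match on the extended diagram be typed. *)
Definition incl_shift_app u (o : option U)
    (AB' : forall u', o = Some u' -> forall i, A u i `<=` B u' i) :
    @Defs.hom (DiagP R) (F u) (ext_ob (DiagP_terminal R) G o) :=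
  match o return
    (forall u', o = Some u' -> forall i, A u i `<=` B u' i) ->
    @Defs.hom (DiagP R) (F u) (ext_ob (DiagP_terminal R) G o) with
  | Some u' => fun AB' =>
      @NatTrans _ _ (subset_diagram_at Ai u) (subset_diagram_at Bi u')
        (fun i => incl_dmap (AB' u' erefl i)) (incl_shift_flag_nat (AB' u' erefl))
  | None => fun _ => t_bang (DiagP_terminal R) (F u)
  end AB'.

Lemma incl_shift_nat u v (uv : ple u v) (o o' : option U) (oo' : ole o o')
    (H : forall u', o = Some u' -> forall i, A u i `<=` B u' i)
    (H' : forall u', o' = Some u' -> forall i, A v i `<=` B u' i) :
  Defs.comp (incl_shift_app H') (@Defs.fmap (preorder_cat U) (DiagP R) F u v uv) =
  Defs.comp (@ext_map U (DiagP R) (DiagP_terminal R) G o o' oo') (incl_shift_app H).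
Proof.
case: o' oo' H' => [v'|] oo' H'; last first.
  exact: (@t_uniq _ (DiagP_terminal R)).
case: o oo' H => [u'|] //= oo' H.
by apply: nat_trans_ext => i; apply: dmap_ext => x; exact: val_inj.
Qed.

Definition incl_shift : Defs.hom F (sh Sh G) :=
  @NatTrans _ _ F (shift_ob (DiagP_terminal R) tP G)
    (fun u => incl_shift_app (fun u' e i => @AB u u' i e))
    (fun u v uv => incl_shift_nat uv (tP uv) _ _).

End one_map.

Lemma incl_shift_comp A B Ai Au Bi Bu (AB : sub_shift t A B) (BA : sub_shift t B A) :
  let F := @subset_diagram R N U A Ai Au in
  Defs.comp (Defs.fmap (sh Sh) (incl_shift Bi Bu Ai Au BA)) (incl_shift Ai Au Bi Bu AB) =
  Defs.comp (sh_unit Sh (sh Sh F)) (sh_unit Sh F).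
Proof.
(* Naturality of the unit rewrites the right-hand side so that [t u] occurs in
   it only as an argument and can be analysed by cases. *)
move=> F; rewrite (@sh_nat _ Sh); apply: nat_trans_ext => u /=.
move: (t_ge u) (fun u' e i => @AB u u' i e); rewrite -/F.
case: (t u) => [u'|] /= uu' AB'; last exact: (@t_uniq _ (DiagP_terminal R)).
move: (t_ge u') (fun u'' e i => @BA u' u'' i e).
case: (t u') => [u''|] /= uu'' BA'; last exact: (@t_uniq _ (DiagP_terminal R)).
by apply: nat_trans_ext => i; apply: dmap_ext => x; exact: val_inj.
Qed.

(** Inclusions compose to inclusions, so the two triangles commute already before
    localization. *)
Lemma subset_diagram_interleaved A B Ai Au Bi Bu :
  sub_shift t A B -> sub_shift t B A ->
  interleaved Sh (@subset_diagram R N U A Ai Au) (@subset_diagram R N U B Bi Bu).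
Proof.
move=> AB BA.
exists (ho_of (incl_shift Ai Au Bi Bu AB)), (ho_of (incl_shift Bi Bu Ai Au BA)).
split; rewrite -?(incl_shift_comp Ai Au Bi Bu AB BA) -?(incl_shift_comp Bi Bu Ai Au BA AB);
  apply: ho_eq_sym; exact: ho_eq_of.
Qed.

End maps.
End interleaving_by_inclusions.

Lemma functor_eq (C D : category) (F0 : C -> D)
    (F1 F1' : forall x y : C, Defs.hom x y -> Defs.hom (F0 x) (F0 y)) p p' q q' :
  (forall x y f, F1 x y f = F1' x y f) ->
  @Functor C D F0 F1 p q = @Functor C D F0 F1' p' q'.
Proof.
move=> FF; have {}FF : F1 = F1'.
  do 2 (apply: functional_extensionality_dep => ?).
  by apply: functional_extensionality_dep => ?; exact: FF.
by subst F1'; rewrite (Prop_irrelevance p p') (Prop_irrelevance q q').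
Qed.

(** Fixing [v] gives a diagram of subsets again, so that inclusions interleave
    it as well. *)
Lemma persistent_atE (R : realType) (N : nat) (v : Omega R) (S : samP R N) :
  persistent_at v S =
  @subset_diagram R N (Rplus R) (fun a => persistent_set S (v, a))
    (fun a => @persistent_set_flag R N S (v, a))
    (fun i a b ab => @persistent_set_mono R N S i (v, a) (v, b) (at_v_mono v ab)).
Proof.
by apply: functor_eq => a b ab; apply: nat_trans_ext => i; apply: dmap_ext => x;
  exact: val_inj.
Qed.

(** * Levels of the distance to the singular stratum *)

Section stratum_distance.
Variables (R : realType) (N : nat).
Implicit Types (S T : samP R N) (x y z : 'rV[R]_N) (A B C : set 'rV[R]_N).

Lemma thicken_comp A B C a b :
  A `<=` thicken B a -> B `<=` thicken C b -> A `<=` thicken C (a + b).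
Proof.
move=> AB BC x /AB[y /BC[z Cz zy] yx]; exists z => //.
by rewrite (le_trans (enorm_tri y _ _))// addrC lerD.
Qed.

Lemma thicken_incl A B a d : A `<=` thicken B d -> thicken A a `<=` thicken B (a + d).
Proof.
by move=> AB; exact: thicken_comp (fun _ => id) AB.
Qed.

Lemma strat_distE S x : (strat_dist S x)%:E =
  Order.min (ereal_inf [set (enorm (x - y))%:E | y in sing S]) 1%E.
Proof.
rewrite /strat_dist fineK// fin_numE; apply/andP; split.
  rewrite gt_eqF// lt_min ltNyr andbT.
  apply: (@lt_le_trans _ _ 0%E) => //; apply: le_ereal_inf_tmp => _ [y _ <-].
  by rewrite lee_fin.
by rewrite lt_eqF// gt_min ltry orbT.
Qed.

Lemma strat_dist_le1 S x : strat_dist S x <= 1.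
Proof. by rewrite -lee_fin strat_distE ge_min lexx orbT. Qed.

Lemma strat_dist_le S x z : sing S z -> strat_dist S x <= enorm (x - z).
Proof.
move=> Sz; rewrite -lee_fin strat_distE ge_min; apply/orP; left.
by apply: ereal_inf_lbound; exists z.
Qed.

Lemma strat_dist_ge S x b : b <= 1 ->
  (forall z, sing S z -> b <= enorm (x - z)) -> b <= strat_dist S x.
Proof.
move=> b1 bS; rewrite -lee_fin strat_distE le_min lee_fin b1 andbT.
by apply: le_ereal_inf_tmp => _ [z Sz <-]; rewrite lee_fin bS.
Qed.

Lemma strat_dist_perturb S T d x y : 0 <= d -> sing T `<=` thicken (sing S) d ->
  strat_dist S x <= strat_dist T y + (enorm (x - y) + d).
Proof.
move=> d0 TS; rewrite -lerBlDr; apply: strat_dist_ge.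
  by rewrite lerBlDr (le_trans (strat_dist_le1 _ _))// lerDl addr_ge0.
move=> z /TS[z' Sz' z'z]; rewrite lerBlDr (le_trans (strat_dist_le x Sz'))//.
rewrite (le_trans (enorm_tri y _ _))// addrCA lerD2l//.
by rewrite (le_trans (enorm_tri z _ _))// lerD2l// enormB.
Qed.

Lemma strat_dist_lipschitz S x y :
  strat_dist S x <= strat_dist S y + enorm (x - y).
Proof.
rewrite -[enorm _]addr0; apply: strat_dist_perturb => // z Sz.
by exists z => //; rewrite subrr enorm0.
Qed.

(** The three entries of a persistent diagram at thickening [0]; treating them
    uniformly in the flag keeps every estimate below to one case. *)
Definition level S (l u : R) (i : flag) : set 'rV[R]_N :=
  [set x | [/\ amb S x, i <> Fp -> l <= strat_dist S x &
                        i <> Fq -> strat_dist S x <= u]].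

Lemma persistent_set_level S (v : Omega R) (a : {nonneg R}) i :
  persistent_set S (v, a) i = thicken (level S (val v).1 (val v).2 i) a%:num.
Proof.
case: i => /=; congr (thicken _ _); apply/seteqP; split=> x /=.
- by move=> [Sx sx]; split.
- by move=> [Sx _ sx]; split => //; exact: sx.
- by move=> [Sx /andP[? ?]]; split.
- by move=> [Sx sx sx']; split => //; rewrite sx// sx'.
- by move=> [Sx sx]; split.
- by move=> [Sx sx _]; split => //; exact: sx.
Qed.

Lemma level_mono S l u l' u' i : l' <= l -> u <= u' ->
  level S l u i `<=` level S l' u' i.
Proof.
move=> ll uu x [Sx sl su]; split=> // [/sl|/su] h.
  exact: le_trans h. exact: le_trans uu.
Qed.

Definition samP_close d S T := [/\ amb S `<=` thicken (amb T) d,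
  amb T `<=` thicken (amb S) d, sing S `<=` thicken (sing T) d &
  sing T `<=` thicken (sing S) d].

Lemma samP_closeC d S T : samP_close d S T -> samP_close d T S.
Proof. by case. Qed.

Lemma level_close d S T l u i : 0 <= d -> samP_close d S T ->
  level S l u i `<=` thicken (level T (l - 2 * d) (u + 2 * d) i) d.
Proof.
move=> d0 [ST _ sST sTS] x [/ST[y Ty yx] sl su]; exists y => //.
have h1 := strat_dist_perturb y x d0 sST; have h2 := strat_dist_perturb x y d0 sTS.
rewrite enormB in h2.
by split=> // [/sl|/su] h; lra.
Qed.

(** Since the distance to the singular set varies by at most [2 * d], widening
    the interval of levels by [e] makes room for the inclusion. *)
Lemma persistent_close d (e : {nonneg R}) S T : 0 <= d -> 2 * d <= e%:num ->
  samP_close d S T ->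
  sub_shift (@OmegaR_add R e) (persistent_set S) (persistent_set T).
Proof.
move=> d0 de ST [v a] u' i; rewrite /OmegaR_add /Omega_add.
case: insubP => //= v' _ v'E [<-].
rewrite !persistent_set_level /= [sval v']v'E /=.
move=> x /(thicken_incl (level_close (i := i) d0 ST)); apply: thickenS; last lra.
by apply: level_mono; lra.
Qed.

End stratum_distance.

Section levels_of_a_cylinder.
Variables (R : realType) (N : nat).
Implicit Types (S W : samP R N) (x y z : 'rV[R]_N).

Lemma pair_continuous (S T : topologicalType) (s : S) :
  continuous (fun t : T => (s, t)).
Proof. by move=> t; apply: cvg_pair => /=; [exact: cvg_cst|exact: cvg_id]. Qed.

(** Sliding along the interval coordinate of the cylinder moves a point
    continuously through all levels. Hence the distance to the singular stratum
    has no local extremum strictly between the strata. *)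
Lemma cylindrical_levels W x e : cylindrically_stratified W ->
  amb W x -> 0 < strat_dist W x < 1 -> 0 < e ->
  exists2 r, 0 < r & forall t, `|t - strat_dist W x| < r ->
    exists x', [/\ amb W x', enorm (x' - x) <= e & strat_dist W x' = t].
Proof.
move=> [_ [h [[hc [g [gc hK gK]]] hs]]] Wx sx e0.
pose x0 : [set x | amb W x /\ 0 < strat_dist W x < 1] :=
  SigSub (mem_set (conj Wx sx)).
have x0E : set_val x0 = x by [].
pose c t : ([set x | amb W x /\ strat_dist W x = 2^-1] * `]0, 1 : R[%classic)%type :=
  ((h x0).1, t).
have cc : continuous (fun t => set_val (g (c t))).
  move=> t; apply: continuous_comp; last exact: initial_continuous.
  apply: continuous_comp; last exact: gc.
  exact: pair_continuous.
have gx : set_val (g (c (h x0).2)) = x.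
  by rewrite -[RHS]x0E -[in RHS](hK x0) /c; case: (h x0).
have : nbhs (set_val (g (c (h x0).2))) [set y | enorm (y - x) < e].
  by rewrite gx; exact: near_enorm.
move=> /(cc (h x0).2).
move=> [B [[V oV VB] BV] Vsub].
have st : (set_val (h x0).2 : R) = strat_dist W x by rewrite hs x0E.
have : nbhs (strat_dist W x) V.
  by apply: open_nbhs_nbhs; split => //; rewrite -st; move: BV; rewrite -VB.
move=> /nbhs_ballP[r /= r0 rV].
have [sx0 sx1] := andP sx.
exists (Num.min r (Num.min (strat_dist W x) (1 - strat_dist W x))).
  by rewrite !lt_min r0 sx0/= subr_gt0.
move=> t; rewrite !lt_min !ltr_norml => /and3P[/andP[t1 t2] /andP[t3 t4] /andP[t5 t6]].
have t01 : `]0, 1 : R[%classic t by rewrite /= in_itv/=; apply/andP; split; lra.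
pose t' : `]0, 1 : R[%classic := SigSub (mem_set t01).
have /Vsub /= xt : B t'.
  rewrite -VB /=; apply: rV; rewrite -ball_normE/= ltr_norml.
  by rewrite (_ : set_val t' = t)//; apply/andP; split; lra.
exists (set_val (g (c t'))); split.
- by have [] := set_mem (valP (g (c t'))).
- exact: ltW.
- by rewrite -hs gK.
Qed.

(** A point at one of the extreme levels [l], [u] is pushed strictly inside along
    the cylinder; by continuity the pushed point serves a whole neighbourhood,
    and finitely many of them give a uniform margin. *)
Lemma level_shrink W l u e : 0 < l -> l < u -> u < 1 ->
  compact (amb W) -> cylindrically_stratified W -> 0 < e -> exists2 r, 0 < r &
  forall i, level W l u i `<=` thicken (level W (l + r) (u - r) i) e.
Proof.
move=> l0 lu u1 Wc Wcyl e0.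
(* A point strictly outside the interval occurs in one of the three levels only,
   where nothing has to be moved. *)
pose Q r x := forall i, level W l u i x -> thicken (level W (l + r) (u - r) i) e x.
suff [r r0 rQ] : exists2 r, 0 < r & forall x, amb W x -> Q r x.
  by exists r => // i x /[dup] -[Wx _ _]; exact: rQ.
apply: compact_common_scale => // [r r' x r'0 r'r Qx i /Qx[x' x'P x'x]|x Wx].
  by exists x' => //; move: x'P; apply: level_mono; lra.
have self y i r : level W (l + r) (u - r) i y -> thicken (level W (l + r) (u - r) i) e y.
  by exists y => //; rewrite subrr enorm0 ltW.
have [xl|lx] := ltP (strat_dist W x) l.
  exists (Num.min (u - l) (l - strat_dist W x)); first by rewrite lt_min !subr_gt0 lu.
  move=> y Wy; rewrite lt_min => /andP[_ yx] i [_ sl su].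
  have := strat_dist_lipschitz W y x => h.
  case: i sl su => sl su; [|by (suff : l <= strat_dist W y by lra); apply: sl..].
  apply: self; split=> // _.
  have : Num.min (u - l) (l - strat_dist W x) <= u - l by rewrite ge_min lexx.
  lra.
have [ux|xu] := ltP u (strat_dist W x).
  exists (Num.min (u - l) (strat_dist W x - u)); first by rewrite lt_min !subr_gt0 lu.
  move=> y Wy; rewrite lt_min => /andP[_ yx] i [_ sl su].
  have := strat_dist_lipschitz W x y => h; rewrite enormB in h.
  case: i sl su => sl su; [by (suff : strat_dist W y <= u by lra); apply: su..|].
  apply: self; split=> // _.
  have : Num.min (u - l) (strat_dist W x - u) <= u - l by rewrite ge_min lexx.
  lra.
have sx : 0 < strat_dist W x < 1 by apply/andP; split; lra.
have e20 : 0 < e / 2 by lra.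
have [r r0 rP] := cylindrical_levels Wcyl Wx sx e20.
have [t [lt tu]] : exists t, [/\ l < t, t < u & `|t - strat_dist W x| < r].
  pose k := Num.min (r / 2) ((u - l) / 4).
  have k0 : 0 < k by rewrite lt_min; apply/andP; split; lra.
  have kr : k <= r / 2 by rewrite ge_min lexx.
  have ku : k <= (u - l) / 4 by rewrite ge_min lexx orbT.
  have [xm|mx] := leP (strat_dist W x) ((l + u) / 2).
    by exists (strat_dist W x + k); rewrite ltr_norml; split; [lra..|apply/andP; split; lra].
  by exists (strat_dist W x - k); rewrite ltr_norml; split; [lra..|apply/andP; split; lra].
move=> /rP[x' [Wx' x'x sx']].
exists (Num.min (e / 2) (Num.min (t - l) (u - t))).
  by rewrite !lt_min; apply/and3P; split; lra.
move=> y Wy yx i _; exists x'; last first.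
  have : Num.min (e / 2) (Num.min (t - l) (u - t)) <= e / 2 by rewrite ge_min lexx.
  by have := enorm_tri x x' y; rewrite (enormB x y); lra.
split=> // _; rewrite sx'.
  rewrite -lerBrDl.
  by rewrite ge_min ge_min lexx orbT.
by rewrite lerBrDl -lerBrDr ge_min ge_min lexx !orbT.
Qed.

(** A point whose level is outside [l, u] has a neighbourhood outside a slightly
    larger interval as well, so a thin enlargement of the interval only adds
    points close to old ones. *)
Lemma level_grow W l u e : l < u -> compact (amb W) -> 0 < e -> exists2 r, 0 < r &
  forall i, level W (l - r) (u + r) i `<=` thicken (level W l u i) e.
Proof.
move=> lu Wc e0; pose Q r x := forall i, level W (l - r) (u + r) i x -> thicken (level W l u i) e x.
suff [r r0 rQ] : exists2 r, 0 < r & forall x, amb W x -> Q r x.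
  by exists r => // i x /[dup] -[Wx _ _]; exact: rQ.
apply: compact_common_scale => // [r r' x r'0 r'r Qx i xP|x Wx].
  by apply: Qx; move: xP; apply: level_mono; lra.
have self y i : level W l u i y -> thicken (level W l u i) e y.
  by exists y => //; rewrite subrr enorm0 ltW.
have [xl|lx] := ltP (strat_dist W x) l.
  exists ((l - strat_dist W x) / 2); first lra.
  move=> y Wy yx i [_ sl su].
  have := strat_dist_lipschitz W y x => h.
  case: i sl su => sl su; [|by (suff : l - (l - strat_dist W x) / 2 <= strat_dist W y by lra); apply: sl..].
  by apply: self; split=> // _; lra.
have [ux|xu] := ltP u (strat_dist W x).
  exists ((strat_dist W x - u) / 2); first lra.
  move=> y Wy yx i [_ sl su].
  have := strat_dist_lipschitz W x y => h; rewrite enormB in h.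
  case: i sl su => sl su; [by (suff : strat_dist W y <= u + (strat_dist W x - u) / 2 by lra); apply: su..|].
  by apply: self; split=> // _; lra.
exists e => // y Wy yx i _; exists x => //.
by rewrite enormB ltW.
Qed.

(** With the interval of levels fixed the slack must come from the thickening:
    a change of the interval by [2 * d] is a Hausdorff perturbation of the
    levels of [W]. *)
Lemma persistent_at_close W v (e : {nonneg R}) : compact (amb W) ->
  cylindrically_stratified W -> 0 < e%:num ->
  exists2 r, 0 < r & forall d S, 0 <= d -> d <= r -> samP_close d S W ->
    sub_shift (@Rplus_add R e) (fun a => persistent_set S (v, a))
                               (fun a => persistent_set W (v, a)) /\
    sub_shift (@Rplus_add R e) (fun a => persistent_set W (v, a))
                               (fun a => persistent_set S (v, a)).
Proof.
move=> Wc Wcyl e0; have e20 : 0 < e%:num / 2 by lra.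
have /and3P[l0 lu u1] := valP v.
have [r1 r10 shrink] := level_shrink l0 lu u1 Wc Wcyl e20.
have [r2 r20 grow] := level_grow lu Wc e20.
exists (Num.min (e%:num / 2) (Num.min (r1 / 2) (r2 / 2))).
  by rewrite !lt_min; apply/and3P; split; lra.
move=> d S d0; rewrite !le_min => /and3P[de d1 d2] SW.
split=> a _ i [<-]; rewrite !persistent_set_level/=.
  apply: subset_trans (thicken_incl (thicken_comp (level_close d0 SW) _)) _.
    apply: subset_trans (@grow i); by apply: level_mono; lra.
  by apply: thickenS => //; lra.
apply: subset_trans (thicken_incl (thicken_comp (shrink i) _)) _.
  exact: level_close d0 (samP_closeC SW).
by apply: thickenS; [apply: level_mono|]; lra.
Qed.

End levels_of_a_cylinder.

(** * Directions and radial steps *)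

Section directions.
Variables (R : realType) (N : nat).
Implicit Types (x y z w : 'rV[R]_N) (a b c s : R) (M X : set 'rV[R]_N).

Definition unitv x : 'rV[R]_N := (enorm x)^-1 *: x.

Lemma unitvK x : enorm x *: unitv x = x.
Proof.
have [->|x0] := eqVneq x 0; first by rewrite enorm0 scale0r.
by rewrite scalerA mulfV ?scale1r// enorm_eq0.
Qed.

Lemma enorm_unitv x : x != 0 -> enorm (unitv x) = 1.
Proof.
move=> x0; rewrite enormZ ger0_norm ?invr_ge0// mulVf//.
by rewrite enorm_eq0.
Qed.

Lemma unitvZ c x : 0 < c -> unitv (c *: x) = unitv x.
Proof.
move=> c0; rewrite /unitv enormZ gtr0_norm// scalerA invfM mulrAC mulVf ?mul1r//.
by rewrite gt_eqF.
Qed.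

(** Rescaling [y] to the length of [x] costs at most [|x - y|], whence the factor
    [2]. *)
Lemma unitv_dist x y : x != 0 ->
  enorm (unitv x - unitv y) <= 2 * enorm (x - y) / enorm x.
Proof.
move=> x0; have xp : 0 < enorm x by rewrite enorm_gt0.
have -> : unitv x - unitv y =
    (enorm x)^-1 *: (x - y) + ((enorm y - enorm x) / enorm x) *: unitv y.
  rewrite scalerBr mulrBl mulfV ?gt_eqF// scalerBl scale1r -addrA; congr (_ + _).
  by rewrite mulrC -scalerA unitvK addKr.
apply: le_trans (enormD _ _) _.
have -> : 2 * enorm (x - y) / enorm x =
    enorm (x - y) / enorm x + enorm (x - y) / enorm x by ring.
rewrite [enorm (_ *: (x - y))]enormZ [enorm (_ *: unitv y)]enormZ lerD//.
  by rewrite ger0_norm ?invr_ge0// mulrC.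
rewrite normrM normfV (gtr0_norm xp).
have [->|y0] := eqVneq y 0.
  by rewrite /unitv scaler0 enorm0 mulr0 divr_ge0.
rewrite enorm_unitv// mulr1 ler_pM2r ?invr_gt0//.
by rewrite distrC enorm_dist.
Qed.

(** The step deviates from the ray through [z] only by the error [`|h| * k]. This
    bounds the change of radius directly, and the change of direction after
    division by the radius. *)
Lemma radial_step z z' h k : z != 0 -> 0 <= k ->
  enorm (z' - z - h *: unitv z) <= `|h| * k -> `|h| * (1 + k) < enorm z ->
  `|enorm z' - (enorm z + h)| <= `|h| * k /\
  enorm (unitv z' - unitv z) <= 2 * (`|h| * k) / enorm z'.
Proof.
move=> z0 k0 step small; set s := enorm z in small *.
have s0 : 0 < s by rewrite enorm_gt0.
have hs : `|h| < s by apply: le_lt_trans small; rewrite ler_peMr// lerDl.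
have sh0 : 0 < s + h by move: hs; rewrite ltr_norml => /andP[]; lra.
have bE : z + h *: unitv z = (s + h) *: unitv z by rewrite scalerDl unitvK.
have zb : enorm (z' - (s + h) *: unitv z) <= `|h| * k.
  by rewrite -bE opprD addrA.
have nb : enorm ((s + h) *: unitv z) = s + h.
  by rewrite enormZ enorm_unitv// mulr1 gtr0_norm.
have h1 : `|enorm z' - (s + h)| <= `|h| * k.
  by rewrite -nb (le_trans (enorm_dist _ _)).
split=> //.
have z'0 : 0 < enorm z'.
  move: h1; rewrite ler_norml => /andP[h1 _].
  have : - `|h| <= h by rewrite lerNl -normrN ler_norm.
  move: small; rewrite mulrDr mulr1; lra.
have -> : unitv z = unitv ((s + h) *: unitv z).
  by rewrite unitvZ// /unitv enorm_unitv// invr1 scale1r.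
apply: le_trans (unitv_dist _ _) _; first by rewrite -enorm_gt0.
by rewrite ler_pM2r ?invr_gt0// ler_pM2l.
Qed.

(** Young's inequality for [t `^ p * 1] with exponents [p^-1] and [(1 - p)^-1]. *)
Lemma powR_bernoulli (p t : R) : 0 < p -> p <= 1 -> 0 < t -> t `^ p <= 1 + p * (t - 1).
Proof.
move=> p0; rewrite le_eqVlt => /predU1P[->|p1] t0; have t0' := ltW t0.
  by rewrite powRr1// mul1r addrC subrK.
have q0 : 0 < 1 - p by lra.
have := @conjugate_powR _ (t `^ p) 1 p^-1 (1 - p)^-1 (powR_ge0 _ _) ler01.
rewrite !invr_gt0 !invrK -powRrM mulfV ?gt_eqF// powRr1// powR1 mulr1 mul1r.
by move=> /(_ p0 q0); rewrite [_ + _]addrC subrK => /(_ erefl); lra.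
Qed.

(** The tangent-line bound for the concave function [x `^ p], in the form that
    compares a drift in direction with the change of the potential [x `^ p]. *)
Lemma powR_chord (p a b : R) : 0 < p -> p <= 1 -> 0 < b -> b <= a ->
  p * (a `^ p / a) * (a - b) <= a `^ p - b `^ p.
Proof.
move=> p0 p1 b0 ba; have a0 : 0 < a by lra.
have [t [t0 bE]] : exists t, 0 < t /\ b = a * t.
  by exists (b / a); rewrite divr_gt0// mulrC divfK// gt_eqF.
have tb := powR_bernoulli p0 p1 t0.
rewrite bE powRM ?(ltW a0) ?(ltW t0)//.
have -> : p * (a `^ p / a) * (a - a * t) = a `^ p * (p * (1 - t)).
  by field; rewrite gt_eqF.
rewrite -{2}[a `^ p]mulr1 -mulrBr ler_wpM2l ?powR_ge0//.
lra.
Qed.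

End directions.

(** * Transport between spheres about a singular point *)

Section transport.
Variables (R : realType) (N : nat).
Implicit Types (x y z : 'rV[R]_N) (X : set 'rV[R]_N).

(** The step changes the radius by at least a fixed fraction of [|h|], hence the
    potential [s `^ p] by at least a multiple of [s `^ p / s * |h|], which is the
    order of the turning. *)
Lemma drift_potential (p h s s' : R) : 0 < p -> p <= 1 -> 0 < s ->
  `|h| <= s / 4 -> `|s' - (s + h)| <= `|h| / 4 ->
  2 * (`|h| * (2 * s `^ p)) / s' <= 16 / p * `|s `^ p - s' `^ p|.
Proof.
move=> p0 p1 s0 hs s'h.
have hh1 : - `|h| <= h by rewrite lerNl -normrN; exact: ler_norm.
have hh2 : h <= `|h| by exact: ler_norm.
have ds : 3 / 4 * `|h| <= `|s - s'|.
  have := ler_normD (s' - (s + h)) (s - s').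
  rewrite (_ : s' - (s + h) + (s - s') = - h); last by ring.
  by rewrite normrN; lra.
have hge0 : 0 <= `|h| by exact: normr_ge0.
have s'0 : s / 2 <= s' by move: s'h; rewrite ler_norml => /andP[]; lra.
have s'p : 0 < s' by lra.
have pz : 0 <= s `^ p by exact: powR_ge0.
have p16 : 0 <= 16 / p by apply: divr_ge0 => //; exact: ltW.
have hpz : 0 <= `|h| * s `^ p by exact: mulr_ge0.
have gen A B : A <= p^-1 * (B * s') -> 2 * (`|h| * (2 * s `^ p)) <= 16 * A ->
    2 * (`|h| * (2 * s `^ p)) / s' <= 16 / p * B.
  move=> AB hA; rewrite ler_pdivrMr//; apply: le_trans hA _.
  by rewrite -!mulrA; apply: ler_wpM2l => //; exact: le_trans AB _.
have [ss|ss] := leP s' s.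
  have ch := powR_chord p0 p1 s'p ss.
  have ds0 : 0 <= s - s' by rewrite subr_ge0.
  rewrite (ger0_norm ds0) in ds.
  have ch0 : 0 <= s `^ p - s' `^ p.
    by rewrite subr_ge0 ge0_ler_powR ?nnegrE// ltW.
  rewrite (ger0_norm ch0).
  apply: (gen (s `^ p * (s' / s) * (s - s'))).
    rewrite (_ : s `^ p * (s' / s) * (s - s') =
      p^-1 * ((p * (s `^ p / s) * (s - s')) * s')); last first.
      by field; rewrite !gt_eqF.
    apply: ler_wpM2l; first by rewrite invr_ge0 ltW.
    by apply: ler_wpM2r => //; exact: ltW.
  have half : 1 / 2 <= s' / s by rewrite ler_pdivlMr//; lra.
  have : s `^ p * (1 / 2) * (3 / 4 * `|h|) <= s `^ p * (s' / s) * (s - s').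
    apply: ler_pM; [by apply: mulr_ge0|by apply: mulr_ge0| |exact: ds].
    by apply: ler_wpM2l.
  lra.
have ch := powR_chord p0 p1 s0 (ltW ss).
have mono : s `^ p <= s' `^ p by rewrite ge0_ler_powR ?nnegrE// ltW.
have ds0 : s - s' <= 0 by rewrite subr_le0 ltW.
rewrite (ler0_norm ds0) opprB in ds.
have ch0 : s `^ p - s' `^ p <= 0 by rewrite subr_le0.
rewrite (ler0_norm ch0) opprB.
apply: (gen (s' `^ p * (s' - s))).
  rewrite (_ : s' `^ p * (s' - s) =
    p^-1 * ((p * (s' `^ p / s') * (s' - s)) * s')); last first.
    by field; rewrite !gt_eqF.
  apply: ler_wpM2l; first by rewrite invr_ge0 ltW.
  by apply: ler_wpM2r => //; exact: ltW.
have : s `^ p * (3 / 4 * `|h|) <= s' `^ p * (s' - s).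
  by apply: ler_pM; [|apply: mulr_ge0| |].
lra.
Qed.

Lemma radial_drift (p h : R) (z z' : 'rV[R]_N) : 0 < p -> p <= 1 -> z != 0 ->
  2 * enorm z `^ p <= 1 / 4 -> `|h| <= enorm z / 4 ->
  enorm (z' - z - h *: unitv z) <= `|h| * (2 * enorm z `^ p) ->
  `|enorm z' - (enorm z + h)| <= `|h| / 4 /\
  enorm (unitv z' - unitv z) <= 16 / p * `|enorm z `^ p - enorm z' `^ p|.
Proof.
move=> p0 p1 z0 k4 hz step.
have s0 : 0 < enorm z by rewrite enorm_gt0.
have k0 : 0 <= 2 * enorm z `^ p by rewrite mulr_ge0// powR_ge0.
have hk : `|h| * (2 * enorm z `^ p) <= `|h| / 4.
  by apply: ler_wpM2l => //; lra.
have small : `|h| * (1 + 2 * enorm z `^ p) < enorm z.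
  by rewrite mulrDr mulr1; lra.
have [h1 h2] := radial_step z0 k0 step small.
have {}h1 : `|enorm z' - (enorm z + h)| <= `|h| / 4 by exact: le_trans hk.
by split=> //; apply: le_trans h2 _; exact: drift_potential.
Qed.

Lemma closed_le_fun (T : topologicalType) (f g : T -> R) :
  continuous f -> continuous g -> closed [set t | f t <= g t].
Proof.
move=> cf cg; rewrite (_ : [set t | _] = (fun t => f t - g t) @^-1` [set s | s <= 0]).
  apply: closed_comp; last exact: closed_le.
  by move=> t _; apply: continuousB; [exact: cf|exact: cg].
by apply/seteqP; split=> t /=; rewrite subr_le0.
Qed.

Lemma dist_continuous y : continuous (fun z => enorm (z - y)).
Proof.
move=> z; apply: (@continuous_comp _ _ _ (fun z => z - y) (@enorm R N)).
  by apply: continuousB; [exact: cvg_id|exact: cst_continuous].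
exact: enorm_continuous.
Qed.

Lemma norm_telescope (a b c : R) :
  (a <= b /\ b <= c) \/ (c <= b /\ b <= a) -> `|a - b| + `|b - c| <= `|a - c|.
Proof.
case=> -[ab bc].
  by rewrite !ler0_norm ?subr_le0 ?(le_trans ab bc)//; lra.
by rewrite !ger0_norm ?subr_ge0 ?(le_trans ab bc)//; lra.
Qed.

(** Among the points of [X] whose direction has drifted by at most the permitted
    amount, take one whose radius is nearest to [rho]. If the radius is not yet
    [rho], a further step along [X] gives a better point, the drift of that step
    being absorbed by the potential [s `^ p], whose derivative dominates the
    turning speed [s `^ p / s]. This extremal argument plays the role of
    following the flow of a radial vector field on [X]. *)
Lemma transport X y (p d : R) : compact X -> 0 < p -> p <= 1 ->
  2 * d `^ p <= 1 / 4 ->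
  (forall z, X z -> 0 < enorm (z - y) <= d -> exists2 h0 : R, 0 < h0 &
     forall h : R, 0 < `|h| < h0 -> exists2 z', X z' &
       enorm (z' - z - h *: unitv (z - y)) <= `|h| * (2 * enorm (z - y) `^ p)) ->
  forall x (rho : R), X x -> 0 < enorm (x - y) <= d -> 0 < rho <= d ->
  exists x', [/\ X x', enorm (x' - y) = rho &
    enorm (unitv (x' - y) - unitv (x - y)) <=
      16 / p * `|enorm (x - y) `^ p - rho `^ p|].
Proof.
move=> cX p0 p1 dp step x rho Xx; set r := enorm (x - y).
move=> /andP[r0 rd] /andP[rho0 rhod].
pose m := Num.min r rho; pose M := Num.max r rho.
have m0 : 0 < m by rewrite lt_min r0.
(* [g] extends [s `^ p] continuously from [m, +oo) to the line, and the last
   condition in [A] is multiplied by the radius: in this form all the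
   conditions are closed on the whole space. *)
pose g s := expR (p * ln (Num.max m s)).
have gE s : m <= s -> g s = s `^ p.
  move=> ms; rewrite /g max_r// /powR gt_eqF//; exact: lt_le_trans ms.
have rm : m <= r by rewrite ge_min lexx.
have gc : continuous g.
  move=> s; apply: continuous_comp; last exact: continuous_expR.
  apply: continuousM; first exact: cst_continuous.
  apply: continuous_comp; last by apply: continuous_ln; rewrite lt_max m0.
  by apply: continuous_max; [exact: cst_continuous|exact: cvg_id].
have dc := @dist_continuous y.
pose A := X `&` ([set z | m <= enorm (z - y)] `&` [set z | enorm (z - y) <= M] `&`
  [set z | enorm ((z - y) - enorm (z - y) *: unitv (x - y)) <=
     enorm (z - y) * (16 / p * `|g r - g (enorm (z - y))|)]).
have cA : compact A.
  apply: compact_closedI => //; apply: closedI; first apply: closedI.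
  - by apply: closed_le_fun => // z; exact: cst_continuous.
  - by apply: closed_le_fun => // z; exact: cst_continuous.
  - apply: closed_le_fun => z.
      apply: (@continuous_comp _ _ _
        (fun z => (z - y) - enorm (z - y) *: unitv (x - y)) (@enorm R N));
        last exact: enorm_continuous.
      apply: continuousB; first by apply: continuousB; [exact: cvg_id|exact: cst_continuous].
      by apply: continuousZl; exact: dc.
    apply: (continuousM (s := fun z => enorm (z - y))
      (t := fun z => 16 / p * `|g r - g (enorm (z - y))|)); first exact: dc.
    apply: (continuousM (s := fun=> 16 / p)); first exact: cst_continuous.
    apply: (@continuous_comp _ _ _ (fun z => g r - g (enorm (z - y))) Num.norm);
      last exact: norm_continuous.
    apply: continuousB; first exact: cst_continuous.
    by apply: continuous_comp; [exact: dc|exact: gc].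
have driftE z : enorm ((z - y) - enorm (z - y) *: unitv (x - y)) =
    enorm (z - y) * enorm (unitv (z - y) - unitv (x - y)).
  by rewrite -{1}(unitvK (z - y)) -scalerBr enormZ ger0_norm.
have AP z : A z -> [/\ X z, m <= enorm (z - y), enorm (z - y) <= M &
    enorm (unitv (z - y) - unitv (x - y)) <=
     16 / p * `|r `^ p - enorm (z - y) `^ p|].
  move=> [Xz [[/= mz zM]]]; rewrite driftE (gE r)// (gE _ mz) ler_pM2l//.
  exact: lt_le_trans mz.
have PA z : X z -> m <= enorm (z - y) -> enorm (z - y) <= M ->
    enorm (unitv (z - y) - unitv (x - y)) <=
     16 / p * `|r `^ p - enorm (z - y) `^ p| -> A z.
  move=> Xz mz zM h; split=> //; split; first by split.
  by rewrite /= driftE (gE r)// (gE _ mz) ler_wpM2l.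
have Ax : A x.
  apply: PA => //; rewrite -/r ?ge_min ?le_max ?lexx//.
  by rewrite !subrr enorm0 normr0 mulr0.
have [|||z zA zmin] := @compact_EVT_min _ _ (fun z => `|enorm (z - y) - rho|) A.
- by exists x.
- exact: cA.
- apply: continuous_subspaceT => z.
  apply: (@continuous_comp _ _ _ (fun z => enorm (z - y) - rho) Num.norm);
    last exact: norm_continuous.
  by apply: continuousB; [exact: dc|exact: cst_continuous].
move: zA; rewrite inE => /AP[Xz mz zM zdrift].
have z0 : 0 < enorm (z - y) by exact: lt_le_trans mz.
have [zr|zr] := eqVneq (enorm (z - y)) rho; first by exists z; rewrite -zr.
exfalso.
have zd : enorm (z - y) <= d by apply: le_trans zM _; rewrite ge_max rd.
have [h0 h00 hP] := step z Xz (introT andP (conj z0 zd)).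
have [s sE] : exists s, s = enorm (z - y) by exists (enorm (z - y)).
have zmin' z' : A z' -> `|s - rho| <= `|enorm (z' - y) - rho|.
  by move=> Az'; rewrite sE; apply: zmin; rewrite inE.
rewrite -sE in mz zM zdrift z0 zr zd hP; clear zmin.
have k4 : 2 * s `^ p <= 1 / 4.
  apply: le_trans dp; apply: ler_wpM2l => //.
  by rewrite ge0_ler_powR ?nnegrE// ltW// (lt_le_trans z0).
have dist0 : 0 < `|rho - s| by rewrite normr_gt0 subr_eq0 eq_sym.
(* Short enough for the step to exist, to stay in the range of [radial_drift],
   and not to jump over the sphere of radius [rho]. *)
have [t [t0 th ts tr]] : exists t, [/\ 0 < t, t < h0, t <= s / 4 & t <= `|rho - s| / 2].
  exists (Num.min (h0 / 2) (Num.min (s / 4) (`|rho - s| / 2))).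
  split; [by rewrite !lt_min !divr_gt0| |by rewrite !ge_min lexx !orbT..].
  by rewrite gt_min; apply/orP; left; rewrite gtr_pMr// invf_lt1// ltr1n.
have improve h : `|h| = t -> exists z', [/\ X z', `|enorm (z' - y) - (s + h)| <= t / 4 &
    enorm (unitv (z' - y) - unitv (x - y)) <=
      16 / p * (`|r `^ p - s `^ p| + `|s `^ p - enorm (z' - y) `^ p|)].
  move=> ht; have [|z' Xz' z'P] := hP h; first by rewrite ht t0.
  have zy : z - y != 0 by rewrite -enorm_gt0 -sE.
  have [|||h1 h2] := @radial_drift p h (z - y) (z' - y) p0 p1 zy.
  - by rewrite -sE.
  - by rewrite ht -sE.
  - by rewrite -sE opprB addrA subrK.
  rewrite -sE ht in h1 h2; exists z'; split=> //.
  apply: le_trans (enorm_tri (unitv (z - y)) _ _) _.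
  by rewrite mulrDr addrC; apply: lerD.
have p16 : 0 <= 16 / p by apply: divr_ge0 => //; exact: ltW.
clear hP step dp k4 gE gc rm dc AP Ax zdrift h00 th.
have [sr|rs] := ltP s rho.
  have rs : r <= s by apply: contraTT mz; rewrite -!ltNge => ?; rewrite lt_min sr andbT.
  have {}tr : t <= (rho - s) / 2 by move: tr; rewrite gtr0_norm ?subr_gt0.
  have [z' [Xz' z's z'd]] := improve t (gtr0_norm t0).
  have [z'1 z'2] : s + t / 2 <= enorm (z' - y) /\ enorm (z' - y) <= rho - t / 2.
    by move: z's; rewrite ler_norml => /andP[]; split; lra.
  have /zmin' : A z'.
    apply: PA => //.
    - by apply: le_trans mz _; lra.
    - by rewrite le_max; apply/orP; right; lra.
    - apply: le_trans z'd _; apply: ler_wpM2l => //.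
      have a1 : r `^ p <= s `^ p by rewrite ge0_ler_powR ?nnegrE// ltW.
      have a2 : s `^ p <= enorm (z' - y) `^ p.
        by rewrite ge0_ler_powR ?nnegrE//; [exact: ltW|exact: ltW|lra].
      exact: norm_telescope (or_introl (conj a1 a2)).
  by rewrite !ler0_norm ?subr_le0; lra.
have {}rs : rho < s by rewrite lt_neqAle eq_sym zr.
have sr : s <= r by apply: contraTT zM; rewrite -!ltNge => ?; rewrite gt_max rs andbT.
have {}tr : t <= (s - rho) / 2.
  by move: tr; rewrite ltr0_norm ?subr_lt0// opprB.
have [|z' [Xz' z's z'd]] := improve (- t); first by rewrite normrN gtr0_norm.
have [z'1 z'2] : rho + t / 2 <= enorm (z' - y) /\ enorm (z' - y) <= s - t / 2.
  by move: z's; rewrite ler_norml => /andP[]; split; lra.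
have /zmin' : A z'.
  apply: PA => //.
  - by rewrite ge_min; apply/orP; right; lra.
  - by apply: le_trans zM; lra.
  - apply: le_trans z'd _; apply: ler_wpM2l => //.
    have a1 : s `^ p <= r `^ p by rewrite ge0_ler_powR ?nnegrE// ltW.
    have a2 : enorm (z' - y) `^ p <= s `^ p.
      by rewrite ge0_ler_powR ?nnegrE//; [exact: ltW|exact: ltW|lra].
    exact: norm_telescope (or_intror (conj a2 a1)).
by rewrite !ger0_norm ?subr_ge0; lra.
Qed.

End transport.

(** * Almost radial curves from the Lojasiewicz condition *)

Section lojasiewicz.
Variables (R : realType) (N : nat).
Implicit Types (x y z w : 'rV[R]_N) (M X : set 'rV[R]_N).

Lemma vec_d_lt (V U : set 'rV[R]_N) v (k : R) : vec_d V U < k -> U 0 -> V v ->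
  enorm v = 1 -> exists2 u, U u & enorm (v - u) < k.
Proof.
move=> dk U0 Vv v1.
pose D v := [set enorm (v - u) | u in U].
have lbD v' : has_lbound (D v') by exists 0 => _ [u _ <-].
have : inf (D v) < k.
  apply: le_lt_trans dk; apply: sup_upper_bound; last by exists v.
  split; first by exists (inf (D v)), v.
  exists 1 => _ [v' [_ v'1] <-]; apply: ge_inf; first exact: (lbD v').
  by exists 0 => //; rewrite subr0.
move=> /inf_lt; case=> [|_ [u Uu <-] vu]; last by exists u.
by exists (enorm (v - 0)), 0.
Qed.

Lemma Ck_cst (V V' : normedModType R) k (U : set V) (a : V') : Ck k U (cst a).
Proof.
elim: k a => [|k IH] a /=; first by move=> x _; exact: cst_continuous.
move=> v; split=> [x _|]; first exact: derivable_cst.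
by rewrite (_ : 'D_v (cst a) = cst 0)//; apply/funext => x; exact: derive_cst.
Qed.

Lemma tangent_space0 M z : M z -> tangent_space M z 0.
Proof.
move=> Mz; exists (cst z), 1; split=> //; last exact: derive_cst.
by move=> k; exact: Ck_cst.
Qed.

(** The difference quotient of a curve with velocity [w] is eventually as close
    to [v] as [w] is; [h] may be negative, so the curve is used both ways. *)
Lemma curve_step M z w (v : 'rV[R]_N) (k : R) : tangent_space M z w ->
  enorm (v - w) < k ->
  exists2 h0 : R, 0 < h0 & forall h : R, 0 < `|h| < h0 ->
    exists2 z', M z' & enorm (z' - z - h *: v) <= `|h| * k.
Proof.
move=> [c [e [e0 csm cM c0 cw]]] vk.
have c1 : derivable (c : R^o -> 'rV[R]_N) 0 1.
  by have [+ _] := csm 1%N 1; apply; rewrite /= in_itv/= oppr_lt0 e0.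
have := c1; rewrite /derivable -/('D_1 (c : R^o -> 'rV[R]_N) 0).
rewrite [X in _ --> X](_ : _ = w)//.
have k0 : 0 < k - enorm (v - w) by rewrite subr_gt0.
move=> /(_ _ (near_enorm w k0)) [r /= r0 rP].
exists (Num.min r e); first by rewrite lt_min r0.
move=> h /andP[h0 +]; rewrite lt_min => /andP[hr he].
have hne : h != 0 by rewrite -normr_gt0.
exists (c h); first by apply: cM; rewrite -ltr_norml.
have ch1 : c (h *: (1 : R^o)) = c h by congr c; exact: mulr1.
have hw : enorm (h^-1 *: (c h - z) - w) < k - enorm (v - w).
  rewrite -c0 -ch1.
  by have := rP h; rewrite /ball_/= sub0r normrN addr0; exact.
have -> : c h - z - h *: v = h *: ((h^-1 *: (c h - z) - w) + (w - v)).
  by rewrite subrKA scalerBr scalerA mulfV// scale1r.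
rewrite enormZ ler_wpM2l//; apply: le_trans (enormD _ _) _.
by rewrite (enormB w v); lra.
Qed.

(** The angle condition supplies, at every point [z] of the space near the
    singular stratum, a curve inside the stratum of [z] that leaves [z] almost
    radially; this is the hypothesis of the transport lemma. *)
Lemma lojasiewicz_radial q (W : samP R N) : compact (amb W) ->
  lojasiewicz_whitney q W ->
  exists p d : R, [/\ 0 < p <= 1, 0 < d, 2 * d `^ p <= 1 / 4 &
    forall y z, sing W y -> amb W z -> 0 < enorm (z - y) <= d ->
    exists2 h0 : R, 0 < h0 & forall h : R, 0 < `|h| < h0 ->
      exists2 z', amb W z' &
        enorm (z' - z - h *: unitv (z - y)) <= `|h| * (2 * enorm (z - y) `^ p)].
Proof.
move=> cW [ws]; have [C cC singE] := ws_sing_closed ws.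
have csing : compact (sing W) by rewrite singE; exact: compact_closedI.
move=> /(_ _ csing (or_introl (fun _ => id)))[a [d0 [a0 d00 beta]]].
exists (Num.min a 1); set p := Num.min a 1.
have p0 : 0 < p by rewrite lt_min a0 /=.
have p1 : p <= 1 by rewrite ge_min lexx orbT.
have pa : p <= a by rewrite ge_min lexx.
(* [d `^ p <= 1 / 8] makes the transversal error of a step at most a quarter of
   its length; [d <= 1] allows lowering the exponent from [a] to [p]. *)
exists (Num.min d0 ((1 / 8) `^ p^-1)).
have e0 : 0 < (1 / 8 : R) `^ p^-1 by apply: powR_gt0; lra.
have e1 : (1 / 8 : R) `^ p^-1 <= 1.
  apply: (@le_trans _ _ (1 `^ p^-1)); last by rewrite powR1.
  rewrite ge0_ler_powR ?nnegrE ?invr_ge0//; [exact: ltW|lra].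
split; [by rewrite p0|by rewrite lt_min d00| |].
  have : Num.min d0 ((1 / 8) `^ p^-1) `^ p <= 1 / 8.
    apply: (@le_trans _ _ (((1 / 8) `^ p^-1) `^ p)).
      rewrite ge0_ler_powR ?nnegrE ?ge_min ?lexx ?orbT//; first exact: ltW.
      by rewrite le_min !ltW.
    by rewrite -powRrM mulVf ?gt_eqF// powRr1//; lra.
  lra.
move=> y z Wy Wz /andP[zy0]; rewrite le_min => /andP[zyd zye].
have zy1 : enorm (z - y) <= 1 by exact: le_trans e1.
pose M := stratum_of W z.
have [MW Mz] : M `<=` amb W /\ M z.
  rewrite /M /stratum_of; case: ifPn => [|]; first by rewrite inE; split=> //; exact: sing_sub.
  by rewrite notin_setE => nz; split=> // t [].
have zny : z != y by apply: contraTneq zy0 => ->; rewrite subrr enorm0 ltxx.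
have := beta y z Wy (conj Wz zyd); rewrite /whitney_beta (negPf zny) -/M => bz.
have vd : vec_d (line z y) (tangent_space M z) < 2 * enorm (z - y) `^ p.
  apply: le_lt_trans bz _; rewrite enormB.
  apply: (@le_lt_trans _ _ (enorm (z - y) `^ p)); first by apply: ger_powR => //; rewrite zy0.
  by rewrite ltr_pMl ?powR_gt0// ltr1n.
have [||w Tw zw] := @vec_d_lt _ _ (unitv (z - y)) _ vd (tangent_space0 Mz).
- by rewrite /line /= memvZ// memv_line.
- by rewrite enorm_unitv// subr_eq0.
have [h0 h00 hP] := curve_step Tw zw.
by exists h0 => // h /hP[z' Mz' z'P]; exists z' => //; exact: MW.
Qed.

End lojasiewicz.

(** * Tangent cones along the singular stratum *)

Section local_cones.
Variables (R : realType) (N : nat).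
Implicit Types (x y z w : 'rV[R]_N) (X Z C : set 'rV[R]_N).

(** Local uniform convergence of the magnifications of [X] to [C]. The radius is
    [2] rather than [1] to leave room for moving the base point and for replacing
    [X] by a sample. *)
Definition conic_along X Z x0 C := forall eta : R, 0 < eta ->
  exists2 e : R, 0 < e & forall x (zeta : R), Z x -> enorm (x - x0) < e ->
    e^-1 < zeta ->
    (forall a, X a -> zeta * enorm (a - x) <= 2 ->
       exists2 c, C c & enorm (zeta *: (a - x) - c) <= eta) /\
    (forall c, C c -> enorm c <= 2 ->
       exists2 a, X a & enorm (zeta *: (a - x) - c) <= eta).

(** [X] is a cone about each point of [Z] up to small changes of direction,
    uniformly over [Z]. *)
Definition radially_conic X Z := forall eta : R, 0 < eta ->
  exists2 d : R, 0 < d & forall y x (rho : R), Z y -> X x ->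
    0 < enorm (x - y) <= d -> 0 < rho <= d ->
    exists x', [/\ X x', enorm (x' - y) = rho &
      enorm (unitv (x' - y) - unitv (x - y)) <= eta].

(** The drift in [transport] is controlled by [d `^ p], which tends to [0] with
    [d] at a rate independent of the base point. *)
Lemma lojasiewicz_radially_conic q (W : samP R N) : compact (amb W) ->
  lojasiewicz_whitney q W -> radially_conic (amb W) (sing W).
Proof.
move=> cW loj eta eta0.
have [p [d [/andP[p0 p1] d0 dp step]]] := lojasiewicz_radial cW loj.
have K0 : 0 < 16 / p by apply: divr_gt0.
pose b := (eta / (16 / p)) `^ p^-1.
have b0 : 0 < b by apply: powR_gt0; apply: divr_gt0.
exists (Num.min d b); first by rewrite lt_min d0.
move=> y x rho Wy Wx /andP[r0 +] /andP[rho0 +].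
rewrite !le_min => /andP[rd rb] /andP[rhod rhob].
have [||x' [Wx' x'rho x'x]] := @transport _ _ (amb W) y p d cW p0 p1 dp
    (fun z => step y z Wy) x rho Wx; [by rewrite r0|by rewrite rho0|].
exists x'; split=> //; apply: le_trans x'x _.
have small s : 0 < s -> s <= b -> 0 <= s `^ p <= eta / (16 / p).
  move=> s0 sb; rewrite powR_ge0/= (_ : eta / (16 / p) = b `^ p).
    by rewrite ge0_ler_powR ?nnegrE// ltW.
  by rewrite /b -powRrM mulVf ?gt_eqF// powRr1// ltW// divr_gt0.
rewrite mulrC -ler_pdivlMr// ler_norml.
have /andP[h1 h2] := small _ r0 rb; have /andP[h3 h4] := small _ rho0 rhob.
by apply/andP; split; lra.
Qed.

Lemma ex_tangent_coneZ X x v (t : R) : X x -> 0 <= t ->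
  ex_tangent_cone X x v -> ex_tangent_cone X x (t *: v).
Proof.
move=> Xx; rewrite le_eqVlt => /predU1P[<- _ e e0|t0 Xv e e0].
  exists x; first by split=> //; rewrite /eball /= subrr enorm0 ltW.
  exists 0; last by rewrite scale0r subrr enorm0 ltW.
  by exists 0 => /=; rewrite ?scale0r.
have [|y [/= yx Xy] [_ [c /= c0 <-] cv]] := Xv (Num.min e (e / t)).
  by rewrite lt_min e0 divr_gt0.
exists y; first by split=> //; apply: le_trans yx _; rewrite ge_min lexx.
exists (t *: (c *: (y - x))).
  by exists (t * c); rewrite /= ?scalerA// mulr_ge0// ltW.
rewrite -scalerBr enormZ gtr0_norm// mulrC -ler_pdivlMr//.
by apply: le_trans cv _; rewrite ge_min lexx orbT.
Qed.

(** Transport [x] to radii tending to [0]: any cluster point of the directions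
    lies in the tangent cone. *)
Lemma ex_tangent_cone_near X (eta d : R) y x : 0 < d ->
  (forall x (rho : R), X x -> 0 < enorm (x - y) <= d -> 0 < rho <= d ->
    exists x', [/\ X x', enorm (x' - y) = rho &
      enorm (unitv (x' - y) - unitv (x - y)) <= eta]) ->
  X x -> 0 < enorm (x - y) <= d ->
  exists c, [/\ ex_tangent_cone X y c, enorm c = 1 &
    enorm (unitv (x - y) - c) <= eta].
Proof.
move=> d0 tr Xx xy.
have rho_n n : 0 < d / n.+1%:R <= d.
  by rewrite divr_gt0//= ler_pdivrMr// ler_peMr ?ler1n// ltW.
have /choice[u uP] n := tr x _ Xx xy (rho_n n).
pose S := [set v : 'rV[R]_N | enorm v = 1] `&`
          [set v | enorm (unitv (x - y) - v) <= eta].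
have cS : compact S.
  apply: bounded_closed_compact.
    exists 1; split=> // M M1 v [/= v1 _].
    by rewrite (le_trans (norm_le_enorm v))// v1 ltW.
  apply: closedI; last first.
    apply: closed_le_fun => v; last exact: cst_continuous.
    under eq_fun do rewrite enormB.
    exact: (@dist_continuous R N (unitv (x - y))).
  rewrite (_ : [set v | _] = [set v | enorm v <= 1] `&` [set v | 1 <= enorm v]).
    apply: closedI; apply: closed_le_fun => v; first exact: enorm_continuous.
    - exact: cst_continuous.
    - exact: cst_continuous.
    - exact: enorm_continuous.
  apply/seteqP; split=> v /=; first by move=> ->.
  by move=> [v1 v2]; apply/eqP; rewrite eq_le v1.
pose w n := unitv (u n - y).
have wS n : S (w n).
  have [_ un uu] := uP n; split=> /=; last by rewrite enormB.
  apply: enorm_unitv; rewrite -enorm_gt0 un; by case/andP: (rho_n n).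
have FS : (w @ \oo) S by exists 0%N => // n _; exact: wS.
have [c [Sc cw]] := cS (w @ \oo) _ FS.
exists c; split=> //; [|exact: Sc.1|exact: Sc.2].
move=> e e0.
have [n0 n0e] : exists n0, forall n, (n0 <= n)%N -> d / n.+1%:R <= e.
  exists (Num.truncn (d / e)) => n n0n; rewrite ler_pdivrMr// mulrC -ler_pdivrMr//.
  by apply: ltW; apply: lt_le_trans (archimedean.Num.Theory.truncnS_gt _) _; rewrite ler_nat.
have [v [[n /= n0n wn] vc]] : [set w n | n in [set n | (n0 <= n)%N]] `&`
    [set v | enorm (v - c) < e] !=set0.
  apply: cw; last exact: near_enorm.
  by exists n0 => // n /= n0n; exists n.
have [Xu un _] := uP n.
exists (u n); first by split=> //; rewrite /eball /= un n0e.
exists (w n); last by rewrite wn ltW.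
exists ((enorm (u n - y))^-1) => //.
by rewrite /= invr_ge0.
Qed.

(** Points of [X] near the moving base point [y'] are compared with the cone at
    [y] on a sphere of fixed radius [d / 2]: travel out along [X] about one of
    the two centres, change the centre, which on that sphere hardly affects
    directions, and travel back in about the other. *)
Lemma ex_tangent_cone_conic_along X Z y : Z `<=` X -> Z y ->
  radially_conic X Z -> conic_along X Z y (ex_tangent_cone X y).
Proof.
move=> ZX Zy conic eta eta0.
(* At most four changes of direction occur, and vectors have length at most [2]. *)
have eta10 : 0 < eta / 8 by rewrite divr_gt0.
have [d d0 tr] := conic _ eta10.
have K x y' : X x -> enorm (y' - y) < d / 4 -> enorm (y' - y) < eta / 8 * (d / 8) ->
    enorm (x - y') = d / 2 \/ enorm (x - y) = d / 2 ->
    [/\ 0 < enorm (x - y) <= d, 0 < enorm (x - y') <= d &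
    enorm (unitv (x - y) - unitv (x - y')) <= eta / 8].
  move=> Xx y'1 y'2 H.
  have [h1 h2] : enorm (x - y) - enorm (y' - y) <= enorm (x - y') /\
      enorm (x - y') - enorm (y' - y) <= enorm (x - y).
    have := enorm_tri y' x y; have := enorm_tri y x y'; rewrite (enormB y y').
    by split; lra.
  have h3 : 0 < enorm (x - y) <= d by apply/andP; split; lra.
  have h4 : 0 < enorm (x - y') <= d by apply/andP; split; lra.
  split=> //; apply: le_trans (unitv_dist _ _) _.
    by rewrite -enorm_gt0; case/andP: h3.
  rewrite (_ : x - y - (x - y') = y' - y); last by rewrite opprB addrC subrKA.
  rewrite ler_pdivrMr; last by case/andP: h3.
  have : eta / 8 * (d / 4) <= eta / 8 * enorm (x - y) by apply: ler_wpM2l; lra.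
  lra.
pose e := Num.min (d / 4) (eta / 8 * (d / 8)).
have [e1 e2] : e <= d / 4 /\ e <= eta / 8 * (d / 8).
  by rewrite /e !ge_min !lexx orbT.
have e0 : 0 < e by rewrite lt_min !divr_gt0// mulr_gt0// divr_gt0.
have cst : exists e : R, [/\ 0 < e, e <= d / 4 & e <= eta / 8 * (d / 8)].
  by exists e.
clear e e1 e2 e0; have [e [e0 e1 e2]] := cst.
exists e => // y' zeta Zy' y'y zetae.
have zeta0 : 0 < zeta by apply: lt_trans zetae; rewrite invr_gt0.
have zeta1 : zeta^-1 < e by rewrite -(invrK e) ltf_pV2// posrE invr_gt0.
have Xy : X y by exact: ZX.
have scaleE (x : 'rV[R]_N) : zeta *: (x - y') = (zeta * enorm (x - y')) *: unitv (x - y').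
  by rewrite -scalerA unitvK.
have yy'1 : enorm (y' - y) < d / 4 by lra.
have yy'2 : enorm (y' - y) < eta / 8 * (d / 8) by lra.
split=> [x Xx xz|c Cc c2].
  have [->|xy'] := eqVneq x y'.
    exists 0; last by rewrite subrr scaler0 subrr enorm0 ltW.
    rewrite -(scale0r 0); apply: ex_tangent_coneZ => // e' e'0.
    exists y; first by split=> //; rewrite /eball /= subrr enorm0 ltW.
    exists 0; last by rewrite subrr enorm0 ltW.
    by exists 0 => //=; rewrite scale0r.
  have r0 : 0 < enorm (x - y') by rewrite enorm_gt0 subr_eq0.
  have rd : enorm (x - y') <= d.
    have : enorm (x - y') <= 2 * zeta^-1 by rewrite ler_pdivlMr// mulrC.
    lra.
  have [||x1 [Xx1 x1y' x1x]] := tr y' x (d / 2) Zy' Xx.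
  - by rewrite r0.
  - by apply/andP; split; lra.
  have [k1 k2 k3] := K x1 y' Xx1 yy'1 yy'2 (or_introl x1y').
  have [c [Cc c1 cx1]] := ex_tangent_cone_near d0 (fun x rho => tr y x rho Zy) Xx1 k1.
  exists ((zeta * enorm (x - y')) *: c).
    by apply: ex_tangent_coneZ => //; rewrite mulr_ge0// ltW.
  rewrite scaleE -scalerBr enormZ ger0_norm; last by rewrite mulr_ge0// ltW.
  have near : enorm (unitv (x - y') - c) <= eta / 8 * 3.
    have t1 := enorm_tri (unitv (x1 - y')) (unitv (x - y')) c.
    have t2 := enorm_tri (unitv (x1 - y)) (unitv (x1 - y')) c.
    by rewrite enormB in k3; rewrite enormB in x1x; lra.
  apply: (@le_trans _ _ (2 * (eta / 8 * 3))); last by lra.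
  by apply: ler_pM => //; rewrite mulr_ge0// ltW.
have [->|cn0] := eqVneq c 0.
  by exists y'; [exact: ZX|rewrite subrr scaler0 subrr enorm0 ltW].
have c0 : 0 < enorm c by rewrite enorm_gt0.
pose e' := Num.min d (Num.min (enorm c / 2) (eta / 16 * enorm c)).
have e'0 : 0 < e' by rewrite !lt_min d0 !(divr_gt0, mulr_gt0).
have [e'1 e'2 e'3] : [/\ e' <= d, e' <= enorm c / 2 & e' <= eta / 16 * enorm c].
  by rewrite /e' !ge_min !lexx !orbT.
have [x0 [/= x0y Xx0] [_ [t /= t0 <-] tc]] := Cc e' e'0.
have tx0 : t *: (x0 - y) != 0.
  apply: contraTneq tc => ->; rewrite sub0r enormN -ltNge.
  by apply: le_lt_trans e'2 _; lra.
have tp : 0 < t.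
  by rewrite lt_neqAle t0 andbT eq_sym; apply: contraNneq tx0 => ->; rewrite scale0r.
have x0p : 0 < enorm (x0 - y).
  by rewrite enorm_gt0; apply: contraNneq tx0 => ->; rewrite scaler0.
have cx0 : enorm (unitv (x0 - y) - unitv c) <= eta / 8.
  rewrite -(unitvZ (x0 - y) tp) enormB; apply: le_trans (unitv_dist _ cn0) _.
  by rewrite enormB ler_pdivrMr//; lra.
have [||x1 [Xx1 x1y x1x0]] := tr y x0 (d / 2) Zy Xx0.
- by rewrite x0p/=; exact: le_trans x0y _.
- by apply/andP; split; lra.
have [k1 k2 k3] := K x1 y' Xx1 yy'1 yy'2 (or_intror x1y).
have [|x2 [Xx2 x2y' x2x1]] := tr y' x1 (enorm c / zeta) Zy' Xx1 k2.
  rewrite divr_gt0//= ; apply: (@le_trans _ _ (2 * zeta^-1)); last lra.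
  by apply: ler_wpM2r => //; rewrite invr_ge0 ltW.
exists x2 => //.
rewrite scaleE x2y' mulrC divfK ?gt_eqF// -[X in _ - X]unitvK -scalerBr enormZ ger0_norm//.
have near : enorm (unitv (x2 - y') - unitv c) <= eta / 8 * 4.
  have t1 := enorm_tri (unitv (x1 - y')) (unitv (x2 - y')) (unitv c).
  have t2 := enorm_tri (unitv (x1 - y)) (unitv (x1 - y')) (unitv c).
  have t3 := enorm_tri (unitv (x0 - y)) (unitv (x1 - y)) (unitv c).
  by rewrite enormB in k3; lra.
apply: (@le_trans _ _ (2 * (eta / 8 * 4))); last by lra.
exact: ler_pM.
Qed.

End local_cones.

(** * Strict differentiability of C1 maps *)

Section strict_differentiability.
Variables (R : realType) (N : nat).
Local Notation E := 'rV[R]_N.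
Implicit Types (x y z : E) (A B : 'M[R]_N).

(** Both points vary: this is what makes estimates at [x0] uniform in the base
    point. *)
Definition strictly_differentiable (f : E -> E) x0 A := forall eta : R, 0 < eta ->
  exists2 e : R, 0 < e & forall x x', enorm (x - x0) < e -> enorm (x' - x0) < e ->
    enorm (f x - f x' - (x - x') *m A) <= eta * enorm (x - x').

Lemma mean_value_bound (phi dphi : R -> R) (a b D eta : R) :
  (forall t, Num.min a b <= t <= Num.max a b ->
     is_derive t 1 phi (dphi t) /\ `|dphi t - D| <= eta) ->
  `|phi b - phi a - (b - a) * D| <= `|b - a| * eta.
Proof.
wlog ab : a b / a <= b.
  move=> W H; have [ab|/ltW ba] := leP a b; first exact: W.
  have := W b a ba; rewrite minC maxC => /(_ H).
  rewrite -normrN (distrC a) (_ : - (_ - _) = phi b - phi a - (b - a) * D)//.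
  ring.
rewrite min_l// max_r// => H.
have [t||c cab ->] := @MVT_segment _ phi dphi a b ab.
- by rewrite in_itv/= => /andP[ta tb]; apply: (H t _).1; rewrite !ltW.
- apply: derivable_within_continuous => t; rewrite in_itv/= => /H[[]]; exact.
have [_ cD] := H c cab.
by rewrite mulrC -mulrBr normrM ler_wpM2l.
Qed.

Lemma is_derive_along (g : E -> R) y v (d : R) (z : R -> E) t :
  (forall h, z (h + t) = h *: v + z t) -> is_derive (z t) v g d ->
  is_derive t 1 (g \o z) d.
Proof.
move=> zE [gd gD].
have eq_quot : (fun h : R => h^-1 *: (((g \o z) \o shift t) (h *: 1) - (g \o z) t)) =
    (fun h => h^-1 *: ((g \o shift (z t)) (h *: v) - g (z t))).
  by apply/funext => h /=; rewrite [h *: 1]mulr1 zE.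
split; first by rewrite /derivable eq_quot.
by rewrite /derive eq_quot.
Qed.

Lemma coord_dist_norm x y i : `|x 0 i - y 0 i| <= `|x - y|.
Proof.
have -> : x 0 i - y 0 i = (x - y) 0 i by rewrite !mxE.
exact: coord_le_norm.
Qed.

(** Change the coordinates of [x'] into those of [x] one at a time; each change
    is governed by the mean value theorem for one entry of one partial
    derivative. *)
Lemma C1_strictly_differentiable (U : set E) (f : E -> E) x0 : open U -> U x0 ->
  Ck 1 U f ->
  strictly_differentiable f x0 (\matrix_i 'D_(delta_mx 0 i) f x0).
Proof.
move=> oU Ux0 fC1 eta eta0.
pose eta' := eta / (N.+1%:R * N.+1%:R).
have eta'0 : 0 < eta' by rewrite divr_gt0// mulr_gt0.
have : \forall x \near x0, U x /\ forall i : 'I_N,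
    `|'D_(delta_mx 0 i) f x - 'D_(delta_mx 0 i) f x0| < eta'.
  apply: filterI; first exact: open_nbhs_nbhs.
  apply: (@filter_forall _ _ (fun (i : 'I_N) x =>
    `|'D_(delta_mx 0 i) f x - 'D_(delta_mx 0 i) f x0| < eta')
    (nbhs x0) (nbhs_filter x0)) => i.
  have [_ /(_ x0 Ux0)] := fC1 (delta_mx 0 i).
  move=> /(_ _ (near_enorm _ eta'0)); apply: (@filterS _ (nbhs x0) (nbhs_filter x0)) => x /=.
  exact: le_lt_trans (norm_le_enorm _).
move=> /nbhs_ballP[e /= e0 eP].
exists e => // x x' xe x'e.
have coord (y : E) : enorm (y - x0) < e -> forall i, `|y 0 i - x0 0 i| < e.
  move=> ye i; apply: le_lt_trans ye; apply: le_trans (norm_le_enorm _).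
  exact: coord_dist_norm.
have {}xe := coord _ xe; have {}x'e := coord _ x'e.
have ballP (y : E) : (forall i, `|y 0 i - x0 0 i| < e) -> ball x0 e y.
  by move=> ye; split=> // i j; rewrite /ball/= distrC (ord1 i).
(* [z k t] has the first [k] coordinates of [x], then [t], then those of [x']. *)
pose z (k : nat) (t : R) : E :=
  \row_i (if (i < k)%N then x 0 i else if i == k :> nat then t else x' 0 i).
have zshift (k : 'I_N) h t : z k (h + t) = h *: delta_mx 0 k + z k t.
  apply/rowP => i; rewrite !mxE eqxx/=.
  case: ltngtP => ik.
  - by rewrite (_ : (i == k) = false) ?mulr0 ?add0r//; apply/negbTE; rewrite -val_eqE/= ltn_eqF.
  - by rewrite (_ : (i == k) = false) ?mulr0 ?add0r//; apply/negbTE; rewrite -val_eqE/= gtn_eqF.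
  - by rewrite (_ : (i == k) = true) ?mulr1//; apply/eqP/val_inj.
have zball (k : 'I_N) t : Num.min (x' 0 k) (x 0 k) <= t <= Num.max (x' 0 k) (x 0 k) ->
    ball x0 e (z k t).
  move=> tk; apply: ballP => i; rewrite mxE; case: ifP => // _; case: eqP => // ik.
  have -> : i = k by exact: val_inj.
  move: tk (xe k) (x'e k); rewrite ge_min le_max !ltr_norml.
  move=> /andP[/orP[] t1 /orP[] t2] /andP[? ?] /andP[? ?]; apply/andP; split; lra.
pose p (k : nat) : E := \row_i (if (i < k)%N then x 0 i else x' 0 i).
have pS (k : 'I_N) : p k.+1 = z k (x 0 k) /\ p k = z k (x' 0 k).
  split; apply/rowP => i; rewrite !mxE.
    by rewrite ltnS leq_eqVlt; case: ltngtP => //= ik; congr (x 0 _); exact: val_inj.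
  by case: ltngtP => //= ik; congr (x' 0 _); exact: val_inj.
have step (k : 'I_N) : `|f (p k.+1) - f (p k) - (x - x') 0 k *: 'D_(delta_mx 0 k) f x0|
    <= `|x - x'| * eta'.
  rewrite [leLHS]/Num.Def.normr/= mx_normrE; apply: bigmax_le.
    by rewrite mulr_ge0// ltW.
  move=> [i j] _ /=; rewrite (ord1 i) !mxE; have [-> ->] := pS k.
  apply: (@le_trans _ _ (`|x 0 k - x' 0 k| * eta')); last first.
    by rewrite ler_wpM2r ?(ltW eta'0)// coord_dist_norm.
  apply: (@mean_value_bound (fun t => f (z k t) 0 j)
    (fun t => 'D_(delta_mx 0 k) f (z k t) 0 j)).
  move=> t tk; have [Uz zD] := eP _ (zball k t tk).
  have fd := (fC1 (delta_mx 0 k)).1 _ Uz.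
  split.
    apply: (@is_derive_along (fun y => f y 0 j) 0 (delta_mx 0 k) _ (z k) t).
      by move=> h; exact: zshift.
    rewrite derive_mx// mxE; apply: derivableP.
    by move/derivable_mxP : fd; exact.
  apply: le_trans (ltW (zD k)).
  exact: coord_dist_norm.
have fE : f x - f x' - (x - x') *m (\matrix_i 'D_(delta_mx 0 i) f x0) =
    \sum_(k < N) (f (p k.+1) - f (p k) - (x - x') 0 k *: 'D_(delta_mx 0 k) f x0).
  rewrite sumrB mulmx_sum_row; congr (_ - _); last first.
    by apply: eq_bigr => k _; rewrite rowK.
  rewrite -(big_mkord xpredT (fun k => f (p k.+1) - f (p k))) telescope_sumr//.
  congr (f _ - f _); apply/rowP => i; rewrite !mxE ?ltn_ord//.
rewrite fE; apply: le_trans (enorm_le_norm _) _.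
apply: (@le_trans _ _ (N.+1%:R * (N.+1%:R * (`|x - x'| * eta')))).
  rewrite ler_wpM2l//; apply: le_trans (ler_norm_sum _ _ _) _.
  apply: (@le_trans _ _ (\sum_(k < N) `|x - x'| * eta')); first exact: ler_sum.
  rewrite sumr_const card_ord -[leLHS]mulr_natl ler_wpM2r ?ler_nat//.
  by rewrite mulr_ge0// ltW.
rewrite (_ : N.+1%:R * _ = eta * `|x - x'|); last first.
  by rewrite /eta'; field.
by rewrite ler_wpM2l ?norm_le_enorm// ltW.
Qed.

Lemma mulmx_enorm_bound A : exists2 K : R, 0 <= K & forall v : E, enorm (v *m A) <= K * enorm v.
Proof.
exists (N.+1%:R * \sum_(ij : 'I_N * 'I_N) `|A ij.1 ij.2|).
  by rewrite mulr_ge0// sumr_ge0.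
move=> v; apply: le_trans (enorm_le_norm _) _; rewrite -mulrA ler_wpM2l//.
have S0 : 0 <= \sum_(ij : 'I_N * 'I_N) `|A ij.1 ij.2| by rewrite sumr_ge0.
rewrite [leLHS]/Num.Def.normr/= mx_normrE; apply: bigmax_le; first by rewrite mulr_ge0.
move=> [i j] _ /=; rewrite (ord1 i) mxE; apply: le_trans (ler_norm_sum _ _ _) _.
rewrite mulr_suml -(pair_bigA _ (fun i j => `|A i j| * enorm v))/=.
apply: ler_sum => k _; rewrite normrM mulrC (bigD1 j)//= -[leLHS]addr0 lerD//.
  by rewrite ler_wpM2l//; apply: le_trans (coord_le_norm _ _) (norm_le_enorm _).
by rewrite sumr_ge0// => l _; rewrite mulr_ge0.
Qed.

End strict_differentiability.

(** * Tangent spaces along the regular stratum *)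

Section charts.
Variables (R : realType) (N : nat).
Local Notation E := 'rV[R]_N.
Implicit Types (x y z : E) (A B : 'M[R]_N).

(** Apply both estimates to [g (f x0 + t h)]: since [f] undoes [g], the vectors
    [t h] and [t h *m B *m A] differ by an arbitrarily small multiple of [t]. *)
Lemma strictly_differentiable_inverse (f g : E -> E) x0 A B :
  strictly_differentiable f x0 A -> strictly_differentiable g (f x0) B ->
  g (f x0) = x0 -> (\forall z \near f x0, f (g z) = z) -> B *m A = 1%:M.
Proof.
move=> fA gB gf fg.
suff H (h : E) : h *m (B *m A) = h.
  by apply/row_matrixP => i; rewrite !rowE H mulmx1.
apply/eqP; rewrite eq_sym -subr_eq0 -enorm_eq0 eq_le enorm_ge0 andbT.
have [KA KA0 KAP] := mulmx_enorm_bound A; have [KB KB0 KBP] := mulmx_enorm_bound B.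
pose K := KA + KB + 1; have K0 : 0 < K by rewrite /K; lra.
have [H0|hn0] := eqVneq h 0; first by rewrite H0 mul0mx subrr enorm0.
have h0 : 0 < enorm h by rewrite enorm_gt0.
apply/ler_addgt0Pr => eps eps0; rewrite add0r.
have [M MK] : exists M, M = K * enorm h by exists (K * enorm h).
have M0 : 0 < M by rewrite MK mulr_gt0.
have [eta [eta0 eta1 etaM]] : exists eta : R, [/\ 0 < eta, eta <= 1 & eta * M <= eps].
  exists (Num.min 1 (eps / M)); split; first by rewrite lt_min ltr01 divr_gt0.
    by rewrite ge_min lexx.
  by rewrite -ler_pdivlMr// ge_min lexx orbT.
have [ef ef0 fP] := fA _ eta0; have [eg eg0 gP] := gB _ eta0.
have [ev ev0 evP] := enorm_nbhs fg.
pose t := Num.min (ef / (2 * M)) (Num.min (eg / (2 * enorm h)) (ev / (2 * enorm h))).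
have t0 : 0 < t by rewrite /t !lt_min !divr_gt0// mulr_gt0.
have [t1 t2 t3] : [/\ t * (2 * M) <= ef, t * (2 * enorm h) <= eg & t * (2 * enorm h) <= ev].
  by rewrite -!ler_pdivlMr ?mulr_gt0// /t !ge_min !lexx !orbT.
have tn : enorm (t *: h) = t * enorm h by rewrite enormZ gtr0_norm.
have th0 : 0 < t * enorm h by exact: mulr_gt0.
move: (t) t0 t1 t2 t3 tn th0 => {}t t0 t1 t2 t3 tn th0.
have near : enorm (f x0 + t *: h - f x0) = t * enorm h by rewrite addrAC subrr add0r.
have fgz : f (g (f x0 + t *: h)) = f x0 + t *: h by apply: evP; rewrite near; lra.
have := gP (f x0 + t *: h) (f x0); rewrite near subrr enorm0 gf.
rewrite (_ : f x0 + t *: h - f x0 = t *: h); last by rewrite addrAC subrr add0r.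
move=> /(_ _ eg0) gz.
have {}gz : enorm (g (f x0 + t *: h) - x0 - t *: h *m B) <= eta * (t * enorm h).
  by apply: gz; lra.
set gt := g _ in gz fgz.
have gtn : enorm (gt - x0) <= (KB + 1) * (t * enorm h).
  have -> : gt - x0 = (gt - x0 - t *: h *m B) + t *: h *m B by rewrite subrK.
  apply: le_trans (enormD _ _) _; rewrite mulrDl mul1r addrC lerD//.
    by rewrite -tn; exact: KBP.
  by apply: le_trans gz _; rewrite ler_piMl// ltW.
have gtM : enorm (gt - x0) <= t * M.
  apply: le_trans gtn _; rewrite MK [leRHS]mulrCA /K.
  by rewrite ler_wpM2r ?(ltW th0)//; lra.
have := fP gt x0; rewrite subrr enorm0 fgz => /(_ _ ef0).
rewrite (_ : f x0 + t *: h - f x0 = t *: h); last by rewrite addrAC subrr add0r.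
have tM : 0 < t * M by exact: mulr_gt0.
have gte : enorm (gt - x0) < ef by lra.
move=> /(_ gte) fz.
have split : t *: (h - h *m (B *m A)) =
    (t *: h - (gt - x0) *m A) + (gt - x0 - t *: h *m B) *m A.
  by rewrite [(gt - x0 - _) *m A]mulmxBl addrA subrK -!scalemxAl mulmxA scalerBr.
have : t * enorm (h - h *m (B *m A)) <= t * (eta * M).
  rewrite -[t in t * enorm _](gtr0_norm t0) -enormZ split.
  apply: le_trans (enormD _ _) _.
  apply: le_trans (lerD fz (KAP _)) _.
  have b1 : eta * enorm (gt - x0) <= eta * ((KB + 1) * (t * enorm h)).
    by rewrite ler_wpM2l// ltW.
  have b2 : KA * enorm (gt - x0 - t *: h *m B) <= KA * (eta * (t * enorm h)).
    by rewrite ler_wpM2l.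
  by rewrite MK /K; lra.
rewrite ler_pM2l// => /le_trans; exact.
Qed.

Lemma pid_mx_coords (d : nat) (z : E) : (d <= N)%N ->
  (forall i : 'I_N, (d <= i)%N -> z 0 i = 0) ->
  z = z *m (pid_mx d : 'M[R]_(N, d)) *m (pid_mx d : 'M[R]_(d, N)).
Proof.
move=> dN z0; rewrite -mulmxA pid_mx_id//; apply/rowP => i.
rewrite mxE (bigD1 i)//= big1 => [|j ji].
  rewrite mxE eqxx/= addr0; case: ltnP => [|/z0->]; first by rewrite mulr1.
  by rewrite mul0r.
by rewrite mxE (_ : (j == i :> nat) = false) ?mulr0//; apply/negbTE.
Qed.

Lemma pid_mx_coords0 (d : nat) (u : 'rV[R]_d) (i : 'I_N) : (d <= i)%N ->
  (u *m (pid_mx d : 'M[R]_(d, N))) 0 i = 0.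
Proof.
move=> di; rewrite mxE big1// => j _; rewrite mxE.
by rewrite (_ : (j == i :> nat) = false) ?mulr0//; apply/negbTE; rewrite neq_ltn (leq_trans (ltn_ord j) di).
Qed.

(** At a regular point the cone is the tangent space of the chart. All the
    estimates are those of a strictly differentiable chart and its inverse at
    the one point [x0], so they hold for every base point near [x0]. *)
Lemma regular_conic_along q (W : samP R N) x0 : whitney_stratified q W ->
  reg W x0 -> exists2 V : {vspace E}, \dim V = q &
  conic_along (amb W) (reg W) x0 [set` V].
Proof.
move=> ws Wx0.
have [qN [U [V [f [g [oU Ux0 oV [sf sg fP gP MP]]]]]]] := ws_reg_smooth ws Wx0.
have [C cC singE] := ws_sing_closed ws.
pose A := \matrix_i 'D_(delta_mx 0 i) f x0.
pose B := \matrix_i 'D_(delta_mx 0 i) g (f x0).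
have fA : strictly_differentiable f x0 A.
  exact: C1_strictly_differentiable oU Ux0 (sf 1%N).
have [Vf0 gf0] := fP _ Ux0.
have gB : strictly_differentiable g (f x0) B.
  exact: C1_strictly_differentiable oV Vf0 (sg 1%N).
have nV : nbhs (f x0) V by exact: open_nbhs_nbhs.
have BA : B *m A = 1%:M.
  apply: strictly_differentiable_inverse fA gB gf0 _.
  by apply: (@filterS _ (nbhs (f x0)) (nbhs_filter _)) nV => z /gP[].
have AB : A *m B = 1%:M by exact: mulmx1C.
pose P : 'M[R]_(q, N) := pid_mx q.
(* The cone is the image of the first [q] coordinates under the differential of
   the inverse chart. *)
pose F : 'Hom('rV[R]_q, 'rV[R]_N) := linfun (mulmxr (P *m B)).
have FE u : F u = u *m P *m B by rewrite lfunE /= mulmxA.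
exists (limg F).
  rewrite limg_dim_eq ?dimvf /dim/= ?mul1n//.
  apply/eqP; rewrite -subv0; apply/subvP => u; rewrite memv_cap memv_ker FE.
  move=> /andP[_ /eqP uPB]; rewrite memv0.
  have : u *m P *m B *m (A *m (pid_mx q : 'M[R]_(N, q))) = 0 by rewrite uPB mul0mx.
  rewrite mulmxA -[_ *m B *m A]mulmxA BA mulmx1 -mulmxA pid_mx_id// pid_mx_1 mulmx1.
  by move=> ->.
move=> eta eta0.
have [KA KA0 KAP] := mulmx_enorm_bound A.
have K10 : 0 < KA + 1 by lra.
have [eta1 [eta10 eta1E]] : exists eta1, 0 < eta1 /\ eta1 * (2 * (KA + 1)) = eta.
  exists (eta / (2 * (KA + 1))); split; first by rewrite divr_gt0// mulr_gt0.
  by rewrite divfK// gt_eqF// mulr_gt0.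
have [ef ef0 fL] := fA _ ltr01; have [eg eg0 gL] := gB _ eta10.
have [ev ev0 evP] := enorm_nbhs nV.
have [eu eu0 euP] := enorm_nbhs (open_nbhs_nbhs (conj oU Ux0)).
have nC : nbhs x0 (~` C).
  apply: open_nbhs_nbhs; split; first exact: closed_openC.
  by move=> Cx0; case: Wx0 => Wx0; apply; rewrite singE.
have [ec ec0 ecP] := enorm_nbhs nC.
(* Points at magnified distance at most [2] from [x] are within [3 * e] of [x0],
   and [f] expands distances there by at most [KA + 1]. *)
have [e [e0 e1 e2 e3 [e4 e5]]] : exists e : R, [/\ 0 < e, 3 * e <= ef, 3 * e <= eu,
    3 * e <= ec & e * (3 * (KA + 1)) <= eg /\ e * (3 * (KA + 1)) <= ev].
  exists (Num.min (ef / 3) (Num.min (eu / 3) (Num.min (ec / 3)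
    (Num.min (eg / (3 * (KA + 1))) (ev / (3 * (KA + 1))))))).
  split; first by rewrite !lt_min !divr_gt0// mulr_gt0.
  - by rewrite mulrC -ler_pdivlMr// ge_min lexx.
  - by rewrite mulrC -ler_pdivlMr// !ge_min lexx !orbT.
  - by rewrite mulrC -ler_pdivlMr// !ge_min lexx !orbT.
  - by rewrite -!ler_pdivlMr ?mulr_gt0// !ge_min !lexx !orbT.
exists e => // x zeta Wx xx0 zetae.
have zeta0 : 0 < zeta by apply: lt_trans zetae; rewrite invr_gt0.
have zeta1 : zeta^-1 < e by rewrite -(invrK e) ltf_pV2// posrE invr_gt0.
have regU a : enorm (a - x0) < 3 * e -> U a.
  by move=> ae; apply: euP; lra.
have Ux : U x by apply: regU; lra.
have fx0 a : enorm (a - x0) < 3 * e -> enorm (f a - f x0) <= (KA + 1) * enorm (a - x0).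
  move=> ae; have := fL a x0; rewrite subrr enorm0 mul1r => h.
  rewrite -[f a - f x0](subrK ((a - x0) *m A)).
  apply: le_trans (enormD _ _) _; rewrite mulrDl mul1r addrC; apply: lerD; first exact: KAP.
  by apply: h => //; lra.
split=> [a Wa|c].
  rewrite mulrC -ler_pdivlMr// => ax.
  have ax0 : enorm (a - x0) < 3 * e by have := enorm_tri x a x0; lra.
  have reg_a : reg W a.
    by split=> //; rewrite singE => -[_ Ca]; apply: (ecP a) Ca; lra.
  have Ua := regU _ ax0.
  exists (zeta *: ((f a - f x) *m B)).
    have z0 (i : 'I_N) : (q <= i)%N -> (zeta *: (f a - f x)) 0 i = 0.
      move=> qi; rewrite !mxE ((MP a Ua).1 reg_a i qi) ((MP x Ux).1 Wx i qi).
      by rewrite subrr mulr0.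
    rewrite /= scalemxAl (pid_mx_coords qN z0) -FE.
    by apply: memv_img; rewrite memvf.
  have [_ ga] := (fP a Ua); have [_ gx] := (fP x Ux).
  have fxe : enorm (f x - f x0) < eg.
    apply: le_lt_trans (fx0 x _) _; first lra.
    have : (KA + 1) * enorm (x - x0) <= (KA + 1) * e by rewrite ler_wpM2l ?ltW.
    have : 0 < (KA + 1) * e by rewrite mulr_gt0.
    lra.
  have fae : enorm (f a - f x0) < eg.
    apply: le_lt_trans (fx0 a ax0) _; apply: lt_le_trans e4.
    by rewrite (_ : e * _ = (KA + 1) * (3 * e)); [rewrite ltr_pM2l|ring].
  have gl := gL _ _ fae fxe; rewrite ga gx in gl.
  rewrite -scalerBr enormZ gtr0_norm//.
  have fax : enorm (f a - f x) <= (KA + 1) * enorm (a - x).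
    rewrite -[f a - f x](subrK ((a - x) *m A)).
    apply: le_trans (enormD _ _) _; rewrite mulrDl mul1r addrC; apply: lerD; first exact: KAP.
    by rewrite -[leRHS]mul1r; apply: fL; lra.
  have zax : zeta * enorm (a - x) <= 2 by rewrite mulrC -ler_pdivlMr.
  apply: (@le_trans _ _ (zeta * (eta1 * ((KA + 1) * enorm (a - x))))).
    rewrite ler_wpM2l ?(ltW zeta0)//; apply: le_trans gl _.
    by rewrite ler_wpM2l// ltW.
  rewrite (_ : zeta * _ = eta1 * (KA + 1) * (zeta * enorm (a - x))); last by ring.
  have : eta1 * (KA + 1) * (zeta * enorm (a - x)) <= eta1 * (KA + 1) * 2.
    by apply: ler_wpM2l => //; rewrite mulr_ge0// ltW.
  lra.
move=> /memv_imgP[u _ cE] c2; rewrite FE in cE.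
pose z := c *m A.
have zE : z = u *m P by rewrite /z cE -[_ *m B *m A]mulmxA BA mulmx1.
have zB : z *m B = c by rewrite /z -mulmxA AB mulmx1.
have zn : enorm z <= KA * 2 by apply: le_trans (KAP c) _; rewrite ler_wpM2l.
pose p := f x + zeta^-1 *: z.
have pfx : p - f x = zeta^-1 *: z by rewrite /p addrAC subrr add0r.
have zz : enorm (zeta^-1 *: z) <= e * (KA * 2).
  rewrite enormZ gtr0_norm ?invr_gt0//; apply: ler_pM => //; last exact: ltW.
  by rewrite invr_ge0 ltW.
have fxn : enorm (f x - f x0) <= (KA + 1) * e.
  by apply: le_trans (fx0 x _) _; [lra|rewrite ler_wpM2l ?ltW].
have ee : 0 < KA * e + e by rewrite -[X in _ + X]mul1r -mulrDl mulr_gt0.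
have pn : enorm (p - f x0) < e * (3 * (KA + 1)).
  have := enorm_tri (f x) p (f x0); rewrite pfx.
  lra.
have Vp : V p by apply: evP; lra.
have [Ugp fgp] := gP p Vp.
have regp : reg W (g p).
  apply/(MP (g p) Ugp) => i qi; rewrite fgp /p zE.
  by rewrite [LHS]mxE [X in _ + X]mxE ((MP x Ux).1 Wx i qi) pid_mx_coords0// mulr0 addr0.
exists (g p); first by case: regp.
have [_ gx] := fP x Ux.
have pe : enorm (p - f x0) < eg by lra.
have fxe : enorm (f x - f x0) < eg by lra.
have := gL _ _ pe fxe; rewrite gx pfx -scalemxAl zB => gl.
rewrite (_ : zeta *: (g p - x) - c = zeta *: (g p - x - zeta^-1 *: c)); last first.
  by rewrite [RHS]scalerBr scalerA mulfV ?gt_eqF// scale1r.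
rewrite enormZ gtr0_norm//.
apply: (@le_trans _ _ (zeta * (eta1 * enorm (zeta^-1 *: z)))).
  by rewrite ler_wpM2l// ltW.
rewrite enormZ gtr0_norm ?invr_gt0// (_ : zeta * _ = eta1 * enorm z); last first.
  by field; rewrite gt_eqF.
have : eta1 * enorm z <= eta1 * (KA * 2) by rewrite ler_wpM2l// ltW.
lra.
Qed.

End charts.

(** * Recovering the stratification from a sample *)

Section recovery.
Variables (R : realType) (N : nat).
Local Notation E := 'rV[R]_N.
Implicit Types (x y z : E) (X Z C S : set E) (W : samP R N) (Phi : set E -> R).

(** [S] is a sample of [X] and [y] a sample of [x], with an error [d] that is
    still small after magnification by [zeta]. *)
Definition fine_sample (r zeta d : R) S X y x := [/\ r^-1 < zeta, 0 <= d,
  zeta * d < r & [/\ S `<=` thicken X d, X `<=` thicken S d & enorm (y - x) <= d]].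

Lemma fine_sample_le r r' zeta d S X y x : 0 < r' -> r' <= r ->
  fine_sample r' zeta d S X y x -> fine_sample r zeta d S X y x.
Proof.
move=> r'0 r'r [z1 d0 z2 SX]; split=> //; last exact: lt_le_trans r'r.
by apply: le_lt_trans z1; rewrite lef_pV2 ?posrE// (lt_le_trans r'0).
Qed.

(** Approximating a vector of the unit ball may leave the ball; since [C] is a
    cone, shrinking by the factor [1 - 2 * eta], or by [(1 + 2 * eta)^-1], returns
    to it at an additional cost of [2 * eta]. *)
Lemma dstar_magnification X Z x0 C (delta : R) : conic_along X Z x0 C ->
  (forall c t, C c -> 0 <= t -> C (t *: c)) -> 0 < delta ->
  exists2 r : R, 0 < r & forall x, Z x -> enorm (x - x0) < r ->
    forall zeta d S y, fine_sample r zeta d S X y x ->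
    (dstar C (magnification zeta y S) < delta%:E)%E.
Proof.
move=> conic cone delta0.
have [eta [eta0 eta1 eta2]] : exists eta : R, [/\ 0 < eta, eta <= 1 / 4 & 8 * eta <= delta].
  exists (Num.min (1 / 4) (delta / 8)); split; first by rewrite lt_min !divr_gt0.
    by rewrite ge_min lexx.
  by rewrite mulrC -ler_pdivlMr// ge_min lexx orbT.
have [e e0 eP] := conic _ eta0.
exists (Num.min e (eta / 2)); first by rewrite lt_min e0 divr_gt0.
move=> x Zx; rewrite lt_min => /andP[xe _] zeta d S y.
have e1 : Num.min e (eta / 2) <= e by rewrite ge_min lexx.
have e2 : Num.min e (eta / 2) <= eta / 2 by rewrite ge_min lexx orbT.
have m0 : 0 < Num.min e (eta / 2) by rewrite lt_min e0 divr_gt0.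
move=> fs; have [ze _ _ _] := fine_sample_le m0 e1 fs.
have [_ d0 zd [SX XS yx]] := fine_sample_le m0 e2 fs.
have zeta0 : 0 < zeta by apply: lt_trans ze; rewrite invr_gt0.
have [toC ofC] := eP x zeta Zx xe ze.
have move_base s a : enorm (s - a) <= d ->
    enorm (zeta *: (s - y) - zeta *: (a - x)) <= eta.
  move=> sa; rewrite -scalerBr enormZ gtr0_norm//.
  rewrite (_ : s - y - (a - x) = (s - a) - (y - x)); last by apply/rowP => i; rewrite !mxE; ring.
  have : enorm (s - a - (y - x)) <= d + d.
    by apply: le_trans (enormD _ _) _; rewrite enormN lerD.
  move=> h; apply: (@le_trans _ _ (zeta * (d + d))); first by rewrite ler_wpM2l// ltW.
  by rewrite mulrDr; lra.
apply: (@le_lt_trans _ _ (4 * eta)%:E); last by rewrite lte_fin; lra.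
apply: ereal_inf_lbound; exists (4 * eta) => //; split; first lra.
- move=> c [Cc]; rewrite /eball /= subr0 => c1.
  have s0 : 0 <= 1 - 2 * eta by lra.
  have c'1 : enorm ((1 - 2 * eta) *: c) <= 1 - 2 * eta.
    by rewrite enormZ ger0_norm// ler_piMr.
  have [|a Xa ac] := ofC _ (cone _ _ Cc s0); first by lra.
  have [s Ss sa] := XS _ Xa.
  have sc := enorm_tri (zeta *: (a - x)) (zeta *: (s - y)) ((1 - 2 * eta) *: c).
  have := move_base _ _ sa => mb.
  have w1 : enorm (zeta *: (s - y)) <= 1.
    by have := enormD (zeta *: (s - y) - (1 - 2 * eta) *: c) ((1 - 2 * eta) *: c); rewrite subrK; lra.
  exists (zeta *: (s - y)).
    by rewrite /magnification /eball; split=> /=; rewrite ?subr0//; split=> //; exists s.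
  apply: le_trans (enorm_tri ((1 - 2 * eta) *: c) _ _) _.
  rewrite [X in _ + enorm X](_ : _ = (- (2 * eta)) *: c).
    rewrite enormZ normrN gtr0_norm; last by lra.
    have : 2 * eta * enorm c <= 2 * eta by rewrite ler_piMr//; lra.
    lra.
  by apply/rowP => i; rewrite !mxE; ring.
- move=> _ [[[s Ss <-] _]]; rewrite /eball /= subr0 => w1.
  have [a Xa sa] := SX _ Ss; rewrite enormB in sa.
  have mb := move_base _ _ sa.
  have az : zeta * enorm (a - x) <= 1 + eta.
    rewrite -[X in X * _](gtr0_norm zeta0) -enormZ.
    have := enorm_tri (zeta *: (s - y)) (zeta *: (a - x)) 0.
    by rewrite !subr0 enormB; lra.
  have [|c Cc ac] := toC a Xa; first by lra.
  have k0 : 0 < 1 + 2 * eta by lra.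
  have cn : enorm c <= 1 + 2 * eta.
    have := enorm_tri (zeta *: (a - x)) c 0; rewrite !subr0 enormB enormZ (gtr0_norm zeta0).
    lra.
  exists ((1 + 2 * eta)^-1 *: c).
    split; first by apply: cone => //; rewrite invr_ge0 ltW.
    rewrite /eball /= subr0 enormZ gtr0_norm ?invr_gt0//.
    by rewrite mulrC ler_pdivrMr// mul1r.
  apply: le_trans (enorm_tri c _ _) _.
  rewrite [X in enorm X + _](_ : _ = (- (2 * eta)) *: ((1 + 2 * eta)^-1 *: c)); last first.
    by apply/rowP => i; rewrite !mxE; field; rewrite gt_eqF.
  rewrite enormZ normrN gtr0_norm; last by lra.
  have c'n : enorm ((1 + 2 * eta)^-1 *: c) <= 1.
    by rewrite enormZ gtr0_norm ?invr_gt0// mulrC ler_pdivrMr// mul1r.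
  have : 2 * eta * enorm ((1 + 2 * eta)^-1 *: c) <= 2 * eta.
    by rewrite ler_piMr//; lra.
  have := enorm_tri (zeta *: (a - x)) c (zeta *: (s - y)).
  rewrite (enormB c (zeta *: (a - x))) (enormB (zeta *: (a - x)) (zeta *: (s - y))).
  lra.
Qed.

Lemma Phi_magnification Phi X Z x0 C (e : R) : sam_star_continuous Phi ->
  conic_along X Z x0 C -> (forall c t, C c -> 0 <= t -> C (t *: c)) -> 0 < e ->
  exists2 r : R, 0 < r & forall x, Z x -> enorm (x - x0) < r ->
    forall zeta d S y, fine_sample r zeta d S X y x ->
    `|Phi C - Phi (magnification zeta y S)| < e.
Proof.
move=> Phic conic cone e0; have [delta delta0 near] := Phic C e e0.
have [r r0 rP] := dstar_magnification conic cone delta0.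
by exists r => // x Zx xx0 zeta d S y fs; apply: near; exact: rP fs.
Qed.

(** The value of [Phi] is known at the limit cones only, one point at a time. The
    limits are locally uniform in the base point, so compactness of the singular
    stratum gives one bound less than [1]; over a compact set of regular points
    [regular_magnifications] is the same argument for the value [1]. *)
Lemma singular_magnifications Phi q W : compact (amb W) ->
  lojasiewicz_whitney q W -> sam_star_continuous Phi ->
  (forall x, sing W x -> Phi (ex_tangent_cone (amb W) x) < 1) ->
  exists2 r : R, 0 < r & forall x zeta d S y, sing W x ->
    fine_sample r zeta d S (amb W) y x -> Phi (magnification zeta y S) <= 1 - r.
Proof.
move=> cW loj Phic PhiW; have conic := lojasiewicz_radially_conic cW loj.
have [C cC singE] := ws_sing_closed loj.1.
have csing : compact (sing W) by rewrite singE; exact: compact_closedI.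
pose Q (r : R) x := forall zeta d S y,
  fine_sample r zeta d S (amb W) y x -> Phi (magnification zeta y S) <= 1 - r.
suff [r r0 rQ] : exists2 r, 0 < r & forall x, sing W x -> Q r x.
  by exists r => // x zeta d S y Wx; exact: rQ.
apply: compact_common_scale => // [r r' x r'0 r'r Qx zeta d S y fs|x Wx].
  by apply: le_trans (Qx _ _ _ _ (fine_sample_le r'0 r'r fs)) _; lra.
have Wx1 := PhiW x Wx; set c := Phi (ex_tangent_cone (amb W) x) in Wx1 *.
have gap : 0 < (1 - c) / 2 by lra.
have ax : amb W x by exact: sing_sub.
have cone v t : ex_tangent_cone (amb W) x v -> 0 <= t -> ex_tangent_cone (amb W) x (t *: v).
  by move=> Cv t0; exact: ex_tangent_coneZ.
have [r r0 rP] := Phi_magnification Phic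
  (ex_tangent_cone_conic_along (@sing_sub _ _ W) Wx conic) cone gap.
rewrite -/c in rP; exists (Num.min r ((1 - c) / 2)); first by rewrite lt_min r0.
move=> y Wy; rewrite lt_min => /andP[yx _] zeta d S y' fs.
have m0 : 0 < Num.min r ((1 - c) / 2) by rewrite lt_min r0.
have m1 : Num.min r ((1 - c) / 2) <= r by rewrite ge_min lexx.
have m2 : Num.min r ((1 - c) / 2) <= (1 - c) / 2 by rewrite ge_min lexx orbT.
have := rP y Wy yx _ _ _ _ (fine_sample_le m0 m1 fs).
by rewrite ltr_norml => /andP[h1 h2]; lra.
Qed.

Lemma regular_magnifications Phi q W K (u : R) : whitney_stratified q W ->
  sam_star_continuous Phi -> (forall V : {vspace E}, \dim V = q -> Phi [set` V] = 1) ->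
  compact K -> K `<=` reg W -> u < 1 ->
  exists2 r : R, 0 < r & forall x zeta d S y, K x ->
    fine_sample r zeta d S (amb W) y x -> u < Phi (magnification zeta y S).
Proof.
move=> ws Phic Philin cK Kreg u1.
pose Q (r : R) x := forall zeta d S y,
  fine_sample r zeta d S (amb W) y x -> u < Phi (magnification zeta y S).
suff [r r0 rQ] : exists2 r, 0 < r & forall x, K x -> Q r x.
  by exists r => // x zeta d S y Wx; exact: rQ.
apply: compact_common_scale => // [r r' x r'0 r'r Qx zeta d S y fs|x Kx].
  exact: Qx (fine_sample_le r'0 r'r fs).
have [V Vq conic] := regular_conic_along ws (Kreg _ Kx).
have cone v t : [set` V] v -> 0 <= t -> [set` V] (t *: v).
  by move=> /= Vv _; exact: memvZ.
have gap : 0 < 1 - u by lra.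
have [r r0 rP] := Phi_magnification Phic conic cone gap.
exists r => // y Ky yx zeta d S y' fs.
have := rP y (Kreg _ Ky) yx _ _ _ _ fs.
by rewrite Philin// ltr_norml => /andP[]; lra.
Qed.

(** A sample point that passes the test comes from a point of [W] that is not in
    the compact set of points at distance [delta'] or more from the singular
    stratum; conversely a sample point next to a singular point passes it. *)
Lemma stratify_close Phi q W : compact (amb W) -> lojasiewicz_whitney q W ->
  sam_star_continuous Phi -> (forall V : {vspace E}, \dim V = q -> Phi [set` V] = 1) ->
  (forall x, sing W x -> Phi (ex_tangent_cone (amb W) x) < 1) ->
  exists2 u0 : R, 0 < u0 < 1 & forall u delta : R, u0 <= u < 1 -> 0 < delta ->
    exists2 r : R, 0 < r & forall zeta d S, r^-1 < zeta -> 0 <= d -> zeta * d < r ->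
      S `<=` thicken (amb W) d -> amb W `<=` thicken S d ->
      samP_close delta (stratify Phi zeta u S) W.
Proof.
move=> cW loj Phic Philin PhiW.
have [r1 r10 singP] := singular_magnifications cW loj Phic PhiW.
exists (Num.max (1 / 2) (1 - r1)).
  by rewrite lt_max gt_max divr_gt0//=; apply/andP; split; lra.
move=> u delta /andP[]; rewrite ge_max => /andP[_ u0] u1 delta0.
have [delta' [delta'0 dd d1]] : exists delta' : R, [/\ 0 < delta', delta' <= delta / 2 & delta' < 1].
  exists (Num.min (delta / 2) (1 / 2)); split; first by rewrite lt_min !divr_gt0.
    by rewrite ge_min lexx.
  by rewrite gt_min; apply/orP; right; lra.
pose K := amb W `&` [set x | delta' <= strat_dist W x].
have sc : continuous (strat_dist W).
  move=> x; apply/(@cvgrPdist_lt _ _ _ (nbhs x)) => e e0.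
  apply: (@filterS _ (nbhs x) (nbhs_filter _) _ _ _ (near_enorm x e0)) => y yx.
  have := strat_dist_lipschitz W x y; have := strat_dist_lipschitz W y x.
  by rewrite (enormB x y) ltr_norml => h1 h2; apply/andP; split; lra.
have cK : compact K.
  by apply: compact_closedI => //; apply: closed_le_fun => // x; exact: cst_continuous.
have Kreg : K `<=` reg W.
  move=> x [Wx /= xd]; split=> // sx; have := strat_dist_le x sx.
  by rewrite subrr enorm0; lra.
have [r2 r20 regP] := regular_magnifications loj.1 Phic Philin cK Kreg u1.
pose r := Num.min r1 (Num.min r2 (Num.min 1 (delta / 2))).
have r0 : 0 < r by rewrite !lt_min r10 r20 ltr01 divr_gt0.
have [rr1 rr2 [rr3 rr4]] : [/\ r <= r1, r <= r2 & r <= 1 /\ r <= delta / 2].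
  by rewrite /r !ge_min !lexx !orbT.
exists r => // zeta d S ze d0 zd SW WS.
have zeta0 : 0 < zeta by apply: lt_trans ze; rewrite invr_gt0.
(* As [r <= 1], magnification only enlarges, so the sample error itself is small. *)
have zeta1 : 1 < zeta by apply: le_lt_trans ze; rewrite invf_ge1.
have dr : d < r by apply: le_lt_trans zd; rewrite ler_peMl// ltW.
have fs x y : enorm (y - x) <= d -> fine_sample r zeta d S (amb W) y x by [].
split=> /=.
- by apply: subset_trans SW _; apply: thickenS => //; lra.
- by apply: subset_trans WS _; apply: thickenS => //; lra.
- move=> y [Sy Phiy]; have [x Wx xy] := SW _ Sy.
  have fsx : fine_sample r zeta d S (amb W) y x by apply: fs; rewrite enormB.
  have xnear : ~ (delta' <= strat_dist W x).
    move=> xd; have := regP _ _ _ _ _ (conj Wx xd) (fine_sample_le r0 rr2 fsx).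
    by rewrite ltNge Phiy.
  have [z sz xz] : exists2 z, sing W z & enorm (x - z) < delta'.
    apply: contra_notP xnear => nz; apply: strat_dist_ge => [|z sz]; first exact: ltW.
    by rewrite leNgt; apply/negP => xz; apply: nz; exists z.
  exists z => //; apply: le_trans (enorm_tri x _ _) _; rewrite (enormB z); lra.
- move=> x Wx; have [y Sy yx] := WS _ (sing_sub Wx).
  exists y; last lra.
  split=> //; have := singP _ _ _ _ _ Wx (fine_sample_le r0 rr1 (fs _ _ yx)).
  lra.
Qed.

Lemma dHd_lt (z r : R) (A B : set E) : 0 < z -> (z%:E * dHd A B < r%:E)%E ->
  exists d : R, [/\ 0 <= d, z * d < r, A `<=` thicken B d & B `<=` thicken A d].
Proof.
move=> z0; rewrite -lte_pdivlMl// -EFinM => /ereal_inf_lt[_ [d [d0 AB BA] <-]].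
rewrite lte_fin ltr_pdivlMl// => dr.
by exists d; split=> //; exact: ltW.
Qed.

Lemma interleaving_dist_cvg0 (C : relcat) (Sh : {nonneg R} -> Defs.shift C)
    (Y : nat -> C) (Z : C) :
  (forall e : {nonneg R}, 0 < e%:num ->
     \forall n \near \oo, interleaved (Sh e) (Y n) Z) ->
  (fun n => interleaving_dist Sh (Y n) Z) @ \oo --> 0%E.
Proof.
move=> YZ.
have ge0 n : (0 <= interleaving_dist Sh (Y n) Z)%E.
  by apply: le_ereal_inf_tmp => _ [e _ <-]; rewrite lee_fin.
have le_e (e : {nonneg R}) : 0 < e%:num ->
    \forall n \near \oo, (interleaving_dist Sh (Y n) Z <= e%:num%:E)%E.
  by move=> /YZ; apply: filterS => n YnZ; apply: ereal_inf_lbound; exists e.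
apply/fine_cvgP; split.
  have := le_e (NngNum ler01) ltr01; apply: filterS => n Dn.
  by rewrite ge0_fin_numE// (le_lt_trans Dn) ?ltry.
apply/cvgrPdist_le => e e0.
have := le_e (NngNum (ltW e0)) e0; apply: filterS => n /= Dn.
rewrite sub0r normrN ger0_norm ?fine_ge0//.
by rewrite -lee_fin fineK// ge0_fin_numE// (le_lt_trans Dn) ?ltry.
Qed.

End recovery.

(** * Convergence of the persistent diagrams *)

Section convergence.
Variables (R : realType) (N : nat).
Implicit Types (W : samP R N) (Phi : set 'rV[R]_N -> R).

Lemma stratify_close_eventually W Phi (u delta r : R) (zeta : nat -> R)
    (Xs : nat -> set 'rV[R]_N) : 0 < r ->
  (forall zeta d S, r^-1 < zeta -> 0 <= d -> zeta * d < r ->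
      S `<=` thicken (amb W) d -> amb W `<=` thicken S d ->
      samP_close delta (stratify Phi zeta u S) W) ->
  (forall n, 0 < zeta n) -> zeta @ \oo --> +oo ->
  (fun n => ((zeta n)%:E * dHd (Xs n) (amb W))%E) @ \oo --> 0%E ->
  \forall n \near \oo, samP_close delta (stratify Phi (zeta n) u (Xs n)) W.
Proof.
move=> r0 rP zeta0 zetaoo dist0.
have n0r : nbhs 0%E [set x : \bar R | (x < r%:E)%E].
  by apply: open_nbhs_nbhs; split; [exact: open_ereal_lt_ereal|rewrite /= lte_fin].
have near_dist : \forall n \near \oo, ((zeta n)%:E * dHd (Xs n) (amb W) < r%:E)%E.
  exact: dist0 n0r.
have near_zeta : \forall n \near \oo, r^-1 < zeta n by move/cvgryPgt : zetaoo; exact.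
near=> n.
have [|d [d0 zd XsW WXs]] := @dHd_lt R N (zeta n) r (Xs n) (amb W) (zeta0 n).
  by near: n.
by apply: rP d0 zd XsW WXs; near: n.
Unshelve. all: by end_near. Qed.

End convergence.

Theorem corollary4p42 (R : realType) (N q : nat) (W : samP R N)
    (Phi : set 'rV[R]_N -> R)
    (W_compact : compact (amb W))
    (W_lojasiewicz : lojasiewicz_whitney q W)
    (W_cylindrical : cylindrically_stratified W)
    (Phi_range : forall B, 0 <= Phi B <= 1)
    (Phi_continuous : sam_star_continuous Phi)
    (Phi_linear : forall V : {vspace 'rV[R]_N}, \dim V = q -> Phi [set` V] = 1)
    (W_Phi : forall x, sing W x -> Phi (ex_tangent_cone (amb W) x) < 1) :
  exists u0 : R, [/\ 0 < u0 < 1,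
    forall u : R, u0 <= u < 1 ->
      forall (zeta : nat -> R) (Xs : nat -> set 'rV[R]_N),
        (forall n, 0 < zeta n) ->
        zeta @ \oo --> +oo ->
        (fun n => ((zeta n)%:E * dHd (Xs n) (amb W))%E) @ \oo --> 0%E ->
        (fun n => interleaving_dist (@OmegaR_shift R)
           (persistent (stratify Phi (zeta n) u (Xs n)))
           (persistent W)) @ \oo --> 0%E &
    forall u : R, u0 <= u < 1 ->
      forall (v : Omega R) (zeta : nat -> R) (Xs : nat -> set 'rV[R]_N),
        (forall n, 0 < zeta n) ->
        zeta @ \oo --> +oo ->
        (fun n => ((zeta n)%:E * dHd (Xs n) (amb W))%E) @ \oo --> 0%E ->
        (fun n => interleaving_dist (@Rplus_shift R)
           (persistent_at v (stratify Phi (zeta n) u (Xs n)))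
           (persistent_at v W)) @ \oo --> 0%E].
Proof.
have [u0 u01 close] :=
  stratify_close W_compact W_lojasiewicz Phi_continuous Phi_linear W_Phi.
exists u0; split=> // u u0u.
  move=> zeta Xs zeta0 zetaoo dist0; apply: interleaving_dist_cvg0 => e e0.
  have delta0 : 0 < e%:num / 2 by rewrite divr_gt0.
  have [r r0 rP] := close u _ u0u delta0.
  apply: filterS (stratify_close_eventually r0 rP zeta0 zetaoo dist0) => n SW.
  have ed : 2 * (e%:num / 2) <= e%:num by rewrite mulrC divfK.
  apply: subset_diagram_interleaved.
    exact: persistent_close (ltW delta0) ed SW.
  exact: persistent_close (ltW delta0) ed (samP_closeC SW).
move=> v zeta Xs zeta0 zetaoo dist0; apply: interleaving_dist_cvg0 => e e0.
have [delta delta0 vP] := persistent_at_close v W_compact W_cylindrical e0.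
have [r r0 rP] := close u _ u0u delta0.
apply: filterS (stratify_close_eventually r0 rP zeta0 zetaoo dist0) => n SW.
have [SsubW WsubS] := vP _ _ (ltW delta0) (lexx _) SW.
rewrite !persistent_atE; exact: subset_diagram_interleaved SsubW WsubS.
Qed.
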